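(* Let $K$ be a non-archimedean local field, $V$ an $n$-dimensional $K$-vector space with basis $v_1,\dots,v_n$, $G=PGL(V)$, and let $\overline{X}=U_0^\wedge\times\overline{A}/\sim$ and $X\subseteq\overline X$ be as in the context. Then $\overline{X}$ is a compact and contractible topological space, and $X$ (the Bruhat–Tits building of $PGL(V)$) is an open, dense subset of $\overline{X}$.
   Context: Notation: $v$ normalized valuation on $K$, $|x|=q^{-v(x)}$, $\underline n=\{1,\dots,n\}$; ''$\subset$'' is strict inclusion. $T\subset G$ is the image of invertible diagonal matrices w.r.t. $v_1,\dots,v_n$, $N$ its normalizer, $N=T\rtimes W$ with $W$ the permutation matrices ($w(v_i)=v_{w(i)}$). Compactified apartment: for nonempty $I\subseteq\underline n$, $A_I$ is the real vector space generated by $\overline\eta^I_i$ ($i\in I$) modulo $\sum_{i\in I}\overline\eta^I_i=0$; $A=A_{\underline n}$, $\eta_i=\overline\eta_i^{\underline n}$; $s_I:A\to A_I$ linear, $\eta_i\mapsto\overline\eta^I_i$ ($i\in I$), $\eta_i\mapsto0$ ($i\notin I$); $\overline A=\bigsqcup_{\emptyset\ne I\subseteq\underline n}A_I$. $N$ acts on $\overline A$ (action $\nu$): $t\in T$ induced by $\mathrm{diag}(d_1,\dots,d_n)$ translates $A_I$ by $\sum_{i\in I}-v(d_i)\overline\eta^I_i$; $w\in W$ maps $A_I\to A_{w(I)}$ linearly, $\overline\eta^I_i\mapsto\overline\eta^{w(I)}_{w(i)}$. Topology on $\overline A$: base consisting of open subsets of $A$ and sets $\Gamma^I_U=(U+\Delta_I)\cup\bigcup_{I\subseteq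 J\subset\underline n}s_J(U+\Delta_I)$ for nonempty $I\subset\underline n$, $U\subset A$ open bounded, $\Delta_I=\sum_{i\notin I}\mathbb R_{\ge0}\eta_i$. Groups: for $i\neq j$ let $a_{ij}:A\to\mathbb R$, $a_{ij}(\sum_kz_k\eta_k)=z_i-z_j$, and let $U_{ij}\subset G$ be the image of the matrices $1+uE_{ij}$, $u\in K$. For $x\in\overline A$ put $f_x(a_{ij})=\inf\{t\in\mathbb R: x\in\overline{\{z\in A: a_{ij}(z)\ge -t\}}\}$ (closure in $\overline A$; $\inf\emptyset=\infty$, $\inf\mathbb R=-\infty$), and $U_{ij,x}=\{1+uE_{ij}: v(u)\ge f_x(a_{ij})\}$ (trivial if $f_x=\infty$, all of $U_{ij}$ if $f_x=-\infty$). Let $U_x$ be the subgroup generated by all $U_{ij,x}$, $N_x=\{n\in N:\nu(n)x=x\}$ and $P_x=N_xU_x$ (a group). Let $Z=\{t\in T:\nu(t)\text{ acts trivially on }A\}$ and $U_0^\wedge=U_0Z$, where $0\in A$ is the origin; $U_0^\wedge$ is a compact open subgroup of $G$. Compactification: on $U_0^\wedge\times\overline A$ define $(g,x)\sim(h,y)$ iff there is $n\in N$ with $\nu(n)x=y$ and $g^{-1}hn\in P_x$; this is an equivalence relation. $\overline X$ is the quotient with the quotient topology, and $X$ denotes the image of $U_0^\wedge\times A$ in $\overline X$, which is identified with the Bruhat–Tits building of $PGL(V)$. *)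

(* Defs.v *)
From HB Require Import structures.
From mathcomp Require Import all_boot all_order all_algebra all_fingroup.
From mathcomp Require Import generic_quotient.
From mathcomp Require Import all_classical all_reals all_analysis.

Set Implicit Arguments.
Unset Strict Implicit.
Unset Printing Implicit Defensive.

Import Order.TTheory GRing.Theory Num.Theory numFieldNormedType.Exports.
Local Open Scope classical_set_scope.
Local Open Scope ring_scope.
Local Open Scope quotient_scope.

Record nonarch_local_field (R : realType) (K : fieldType) (v : K -> \bar R) : Prop := {
  nlf_v0 : forall x, v x = +oo%E <-> x = 0;
  nlf_vZ : forall x, x != 0 -> exists k : int, v x = (k%:~R)%:E;
  nlf_normalized : exists pi : K, v pi = 1%:E;
  nlf_vM : forall x y, v (x * y)%R = (v x + v y)%E;
  nlf_vD : forall x y, (Order.min (v x) (v y) <= v (x + y)%R)%E;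
  nlf_complete : forall u : nat -> K,
    (forall k : R, exists N : nat, forall p q, (N <= p)%N -> (N <= q)%N -> (k%:E <= v (u p - u q)%R)%E) ->
    exists l : K, forall k : R, exists N : nat, forall p, (N <= p)%N -> (k%:E <= v (u p - l)%R)%E;
  nlf_residue_finite : exists s : seq K, (forall r, r \in s -> (0 <= v r)%E) /\
    forall x, (0 <= v x)%E -> exists2 r, r \in s & (1 <= v (x - r)%R)%E
}.

Section Apartment.
Variables (R : realType) (n : nat).

Definition sI (I : {set 'I_n.+1}) (w : 'rV[R]_n.+1) : 'rV[R]_n.+1 :=
  \row_i (if i \in I then w 0 i - (\sum_(j in I) w 0 j) / #|I|%:R else 0).

Definition Abar_pred (p : {set 'I_n.+1} * 'rV[R]_n.+1) : bool :=
  [&& p.1 != finset.set0, [forall i, (i \notin p.1) ==> (p.2 0 i == 0)]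
    & \sum_(i in p.1) p.2 0 i == 0].

Record Abar := MkAbar { abval : {set 'I_n.+1} * 'rV[R]_n.+1; _ : Abar_pred abval }.
HB.instance Definition _ := [isSub for abval].
HB.instance Definition _ := [Choice of Abar by <:].

Definition A_basic (O : set 'rV[R]_n.+1) : set Abar :=
  [set x | exists2 w, O w & abval x = ([set: 'I_n.+1]%SET, sI [set: 'I_n.+1]%SET w)].

Definition Gamma (I : {set 'I_n.+1}) (W : set 'rV[R]_n.+1) : set Abar :=
  [set x | exists J : {set 'I_n.+1}, I \subset J /\
     exists2 w, W w & exists t : 'rV[R]_n.+1, (forall i, 0 <= t 0 i) /\
       (forall i, i \in I -> t 0 i = 0) /\ abval x = (J, sI J (w + t))].

Definition Abar_base : set (set Abar) :=
  [set B | (exists2 O : set 'rV[R]_n.+1, open O & B = A_basic O) \/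
           (exists I (W : set 'rV[R]_n.+1), [/\ I != finset.set0, I != [set: 'I_n.+1]%SET, open W, bounded_set W & B = Gamma I W])].

HB.instance Definition _ := @isSubBaseTopological.Build Abar (set Abar) Abar_base id.

Definition Sij (i j : 'I_n.+1) (t : R) : set Abar :=
  [set y | (abval y).1 = [set: 'I_n.+1]%SET /\ - t <= (abval y).2 0 i - (abval y).2 0 j].

Definition fx (p : {set 'I_n.+1} * 'rV[R]_n.+1) (i j : 'I_n.+1) : \bar R :=
  ereal_inf [set t%:E | t in [set t : R | exists x : Abar, abval x = p /\ closure (Sij i j t) x]].

End Apartment.

Section Compactification.
Variables (R : realType) (K : fieldType) (v : K -> \bar R) (n : nat).

Local Notation Ab := (Abar R n).
Local Notation Icar := ({set 'I_n.+1} * 'rV[R]_n.+1)%type.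

(* the monomial matrix  diag(d) * (permutation matrix of s) :  v_i |-> d_(s i) v_(s i) *)
Definition mono (s : {perm 'I_n.+1}) (d : 'I_n.+1 -> K) : 'M[K]_n.+1 :=
  \matrix_(k, i) (if k == s i then d k else 0).

(* the action nu of mono s d on the compactified apartment (on normalized representatives) *)
Definition nu (s : {perm 'I_n.+1}) (d : 'I_n.+1 -> K) (p : Icar) : Icar :=
  ((s @: p.1)%SET,
   sI (s @: p.1)%SET (\row_k (p.2 0 ((s^-1)%g k) - fine (v (d k))))).

Definition elem (i j : 'I_n.+1) (u : K) : 'M[K]_n.+1 := 1%:M + u *: delta_mx i j.

Definition Ugen (F : 'I_n.+1 -> 'I_n.+1 -> \bar R) (g : 'M[K]_n.+1) : Prop :=
  exists s : seq ('I_n.+1 * 'I_n.+1 * K),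
    all (fun e => (e.1.1 != e.1.2) && (F e.1.1 e.1.2 <= v e.2)%E) s /\
    g = \prod_(e <- s) elem e.1.1 e.1.2 e.2.

Definition Ux (p : Icar) : 'M[K]_n.+1 -> Prop := Ugen (fx p).

Definition Nx (p : Icar) (m : 'M[K]_n.+1) : Prop :=
  exists s d, (forall k, d k != 0) /\ m = mono s d /\ nu s d p = p.

Definition Px (p : Icar) (g : 'M[K]_n.+1) : Prop :=
  exists m u, Nx p m /\ Ux p u /\ g = m * u.

Definition Ztilde (t : 'M[K]_n.+1) : Prop :=
  exists d, (forall k, d k != 0) /\ t = mono 1%g d /\
    forall x : Ab, (abval x).1 = [set: 'I_n.+1]%SET -> nu 1%g d (abval x) = abval x.

Definition origin : Icar := ([set: 'I_n.+1]%SET, 0).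

Definition U0hat (g : 'M[K]_n.+1) : Prop :=
  exists u t, Ugen (fx origin) u /\ Ztilde t /\ g = u * t.

Record Ucar := MkUcar { ucval : 'M[K]_n.+1; _ : `[< U0hat ucval >] }.
HB.instance Definition _ := [isSub for ucval].
HB.instance Definition _ := [Choice of Ucar by <:].

Definition Ucar_base : set (set Ucar) :=
  [set B | exists (i j : 'I_n.+1) (a : K) (k : R),
      B = [set g : Ucar | (k%:E < v (ucval g i j - a))%E]].

HB.instance Definition _ := @isSubBaseTopological.Build Ucar (set Ucar) Ucar_base id.

Definition sim (a b : Ucar * Ab) : Prop :=
  exists s d, (forall k, d k != 0) /\ nu s d (abval a.2) = abval b.2 /\
    Px (abval a.2) ((ucval a.1)^-1 * ucval b.1 * mono s d).

Definition eqclos (T : Type) (r : T -> T -> Prop) (a b : T) : Prop :=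
  forall E : T -> T -> Prop, (forall x, E x x) -> (forall x y, E x y -> E y x) ->
    (forall x y z, E x y -> E y z -> E x z) -> (forall x y, r x y -> E x y) -> E a b.

Definition simb : rel (Ucar * Ab) := fun a b => `[< eqclos sim a b >].

Lemma simb_refl : reflexive simb.
Proof. by move=> a; apply/asboolP => E r _ _ _; exact: r. Qed.

Lemma simb_sym : symmetric simb.
Proof.
have H : forall a b, simb a b -> simb b a.
  move=> a b /asboolP H; apply/asboolP => E r s t h; exact: (s _ _ (H E r s t h)).
by move=> a b; apply/idP/idP; apply: H.
Qed.

Lemma simb_trans : transitive simb.
Proof.
move=> b a c /asboolP H1 /asboolP H2; apply/asboolP => E r s t h.
apply: (t _ b); [exact: H1|exact: H2].
Qed.

Definition sim_equiv := EquivRel simb simb_refl simb_sym simb_trans.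

Definition Xbar := {eq_quot sim_equiv}.
HB.instance Definition _ := Topological.copy Xbar (quotient_topology Xbar).
HB.instance Definition _ := Quotient.on Xbar.

Definition Xset : set Xbar :=
  [set \pi_Xbar p | p in [set p : Ucar * Ab | (abval p.2).1 = [set: 'I_n.+1]%SET]].

End Compactification.

Definition contractible (R : realType) (T : topologicalType) : Prop :=
  exists (H : T * R -> T) (c : T),
    {within [set p : T * R | 0 <= p.2 <= 1], continuous H} /\
    (forall x, H (x, 0) = x) /\ (forall x, H (x, 1) = c).

(* Main.v *)
(* A point of the compactified apartment is a diagonal seminorm on V up to scaling: the
   coordinates x_i, i in I, become the weights exp(- x_i), and the directions outside I get the
   weight 0.  Normalizing the largest weight to 1 identifies the compactified apartment with
   the compact set of nonzero vectors in [0,1]^n having a coordinate 1.  A pair (g, x) becomes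
   the seminorm w |-> max_i r_i |(g^-1 w)_i|, and equivalent pairs have homothetic seminorms;
   conversely, homothetic norms (all weights positive) come from equivalent pairs, by a
   Gaussian elimination adapted to the weights.

   Compactness is that of GL_n(O) times the apartment.  The contraction replaces the normalized
   weights r_i by max(r_i, s), 0 <= s <= 1: it commutes with GL_n(O), so it descends to the
   quotient, it ends at the class of the origin, and for s > 0 it lands in X, which also gives
   density. *)
Require Import Defs.
From HB Require Import structures.
From mathcomp Require Import all_boot all_order all_algebra all_fingroup.
From mathcomp Require Import generic_quotient.
From mathcomp Require Import all_classical all_reals all_analysis.
From mathcomp Require Import ring lra.
Import Order.TTheory GRing.Theory Num.Theory numFieldNormedType.Exports.
Local Open Scope classical_set_scope.
Local Open Scope ring_scope.

Set Implicit Arguments.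
Unset Strict Implicit.
Unset Printing Implicit Defensive.

(** * The absolute value of the local field *)

(** The relation [simb] is the equivalence closure of [sim], so equality in the quotient can be
    exploited only through an invariant. [homothetic] is such an invariant on the whole compactified
    apartment; the converse is proved for full support only. This asymmetry decides how much of [fx]
    has to be known. At boundary points one implication is enough: the generators of [Ux] preserve
    the weights. The reverse implication concerns interior points, which lie in the sets [Sij]
    themselves, so that no closure has to be computed. This suffices because truncation at a level s
    > 0 produces positive weights, while truncation at 0 is the identity.

    Taking max(r_i, s) does not commute with scaling, so a homothety factor between equivalent pairs
    would be fatal. Scaling the group elements into GL_n(O) and the largest weight to 1 removes it:
    every row of an element of GL_n(O) has a unit entry, which forces the factor to be 1. Truncation
    then replaces a norm N by max(N, s * sup norm), and GL_n(O) preserves the sup norm. *)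

Section AbsoluteValue.
Variables (R : realType) (K : fieldType) (v : K -> \bar R).

(** The base is e instead of q, which turns comparisons with exp(- a) into comparisons of v with a
    and matches the weights exp(- x_i) of the apartment. Zero is treated apart because [fine] sends
    +oo to 0. *)
Definition absv (x : K) : R := if x == 0 then 0 else expR (- fine (v x)).

Hypothesis hv : nonarch_local_field v.

Lemma v_fin x : x != 0 -> v x = (fine (v x))%:E.
Proof. by move=> x0; have [k ->] := nlf_vZ hv x0. Qed.

Lemma v0 : v 0 = +oo%E.
Proof. exact: (iffRL (nlf_v0 hv 0)). Qed.

Lemma absv0 : absv 0 = 0.
Proof. by rewrite /absv eqxx. Qed.

Lemma absv_ge0 x : 0 <= absv x.
Proof. by rewrite /absv; case: ifP => // _; exact: expR_ge0. Qed.

Lemma absv_gt0 x : (0 < absv x) = (x != 0).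
Proof. by rewrite /absv; case: eqP => _; rewrite ?ltxx ?expR_gt0. Qed.

Lemma absv_le (a : R) x : (absv x <= expR (- a)) = (a%:E <= v x)%E.
Proof.
rewrite /absv; case: eqVneq => [->|x0]; first by rewrite v0 leey expR_ge0.
by rewrite ler_expR lerN2 [in RHS]v_fin// lee_fin.
Qed.

Lemma absv_lt (a : R) x : (absv x < expR (- a)) = (a%:E < v x)%E.
Proof.
rewrite /absv; case: eqVneq => [->|x0]; first by rewrite v0 ltry expR_gt0.
by rewrite ltr_expR ltrN2 [in RHS]v_fin// lte_fin.
Qed.

Lemma absvM x y : absv (x * y) = absv x * absv y.
Proof.
rewrite /absv mulf_eq0.
case: eqVneq => [->|x0]; first by rewrite /= mul0r.
case: eqVneq => [->|y0]; first by rewrite /= mulr0.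
by rewrite -expRD -opprD (nlf_vM hv) (v_fin x0) (v_fin y0).
Qed.

Lemma absv1 : absv 1 = 1.
Proof.
have /mulfI : absv 1 != 0 by rewrite gt_eqF// absv_gt0 oner_eq0.
by apply; rewrite -absvM !mulr1.
Qed.

Lemma absvV x : absv x^-1 = (absv x)^-1.
Proof.
case: (eqVneq x 0) => [->|x0]; first by rewrite invr0 absv0 invr0.
have /mulfI : absv x != 0 by rewrite gt_eqF// absv_gt0.
by apply; rewrite -absvM !mulfV// ?absv1// gt_eqF// absv_gt0.
Qed.

Lemma absvN x : absv (- x) = absv x.
Proof.
have N1 : absv (- 1) = 1.
  have /eqP : absv (-1) ^+ 2 = 1 by rewrite expr2 -absvM mulrNN mulr1 absv1.
  rewrite sqrf_eq1 => /orP[/eqP//|/eqP h].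
  by have := absv_ge0 (-1); rewrite h ler0N1.
by rewrite -mulN1r absvM N1 mul1r.
Qed.

Lemma absvD (c : R) x y : absv x <= c -> absv y <= c -> absv (x + y) <= c.
Proof.
have [->|x0] := eqVneq x 0; first by rewrite add0r.
move=> hx; have c0 : 0 < c by rewrite (lt_le_trans _ hx)// absv_gt0.
move: hx; rewrite -(lnK c0) -[ln c]opprK !absv_le => hx hy.
by rewrite (le_trans _ (nlf_vD hv x y))// le_min hx.
Qed.

Lemma absvB (c : R) x y : absv x <= c -> absv y <= c -> absv (x - y) <= c.
Proof. by move=> ? ?; apply: absvD; rewrite ?absvN. Qed.

Lemma absv_sum (I : finType) (P : pred I) (F : I -> K) (c : R) : 0 <= c ->
  (forall i, P i -> absv (F i) <= c) -> absv (\sum_(i | P i) F i) <= c.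
Proof.
move=> c0 h; elim/big_ind: _ => //; first by rewrite absv0.
by move=> x y; exact: absvD.
Qed.

Lemma absvD_lt (c : R) x y : absv x < c -> absv y < c -> absv (x + y) < c.
Proof.
move=> hx hy; apply: (@le_lt_trans _ _ (Num.max (absv x) (absv y))).
  by apply: absvD; rewrite le_max lexx ?orbT.
by rewrite gt_max hx.
Qed.

Lemma absv_sum_lt (I : finType) (P : pred I) (F : I -> K) (c : R) : 0 < c ->
  (forall i, P i -> absv (F i) < c) -> absv (\sum_(i | P i) F i) < c.
Proof.
move=> c0 h; elim/big_ind: _ => //; first by rewrite absv0.
by move=> x y; exact: absvD_lt.
Qed.

Lemma absv_prod (I : finType) (P : pred I) (F : I -> K) :
  absv (\prod_(i | P i) F i) = \prod_(i | P i) absv (F i).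
Proof. by rewrite (big_morph _ absvM absv1). Qed.

Lemma absv_sign (b : bool) x : absv ((-1) ^+ b * x) = absv x.
Proof. by case: b; rewrite ?expr1 ?mulN1r ?absvN// expr0 mul1r. Qed.

Lemma absv_inv1 x : absv x = 1 -> absv x^-1 = 1.
Proof. by move=> h; rewrite absvV h invr1. Qed.

End AbsoluteValue.

(** * Elimination in the stabilizer of a weighted norm *)

(** Cancelling the positive product of the other b_j in the product inequality leaves b_i <= a_i.
    This is how a bound on a determinant becomes an equality for each entry along a permutation. *)
Lemma prod_squeeze (R : realFieldType) (I : finType) (a b : I -> R) :
  (forall i, 0 <= a i <= b i) -> (forall i, 0 < b i) ->
  \prod_i b i <= \prod_i a i -> forall i, a i = b i.
Proof.
move=> ab b0 h i; have /andP[ai0 aib] := ab i.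
apply/le_anti; rewrite aib /=; move: h.
rewrite (bigD1 i)//= [in X in _ <= X](bigD1 i)//= => h.
have p0 : 0 < \prod_(j | j != i) b j by apply: prodr_gt0.
rewrite -(ler_pM2r p0); apply: (le_trans h); apply: ler_wpM2l => //.
by apply: ler_prod.
Qed.

(** * Elementary matrices as row and column operations *)

Section Elementary.
Variables (K : fieldType) (n : nat).
Implicit Types (i j : 'I_n.+1) (u : K) (M : 'M[K]_n.+1).

Lemma elemE i j u a b :
  elem i j u a b = (a == b)%:R + u * ((a == i) && (b == j))%:R.
Proof. by rewrite /elem !mxE. Qed.

Lemma elem_mull i j u M a b :
  (elem i j u * M) a b = M a b + (a == i)%:R * (u * M j b).
Proof.
rewrite /elem mulrDl mul1r !mxE; congr (_ + _).
rewrite (bigD1 j)//= big1 ?addr0 => [|k kj]; rewrite !mxE ?eqxx ?andbT.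
  by rewrite [RHS]mulrA [_%:R * u]mulrC.
by rewrite (negPf kj) andbF mulr0 mul0r.
Qed.

Lemma elem_mulr i j u M a b :
  (M * elem i j u) a b = M a b + (b == j)%:R * (u * M a i).
Proof.
rewrite /elem mulrDr mulr1 !mxE; congr (_ + _).
rewrite (bigD1 i)//= big1 ?addr0 => [|k ki]; rewrite !mxE ?eqxx /=.
  by rewrite mulrC [u * _]mulrC -mulrA.
by rewrite (negPf ki) mulr0 mulr0.
Qed.

Lemma elemD i j u w : i != j -> elem i j u * elem i j w = elem i j (u + w).
Proof.
move=> ij; apply/matrixP => a b.
rewrite elem_mull !elemE (eq_sym j i) (negPf ij) (eq_sym j b) andFb mulr0 addr0.
by rewrite -mulnb natrM; ring.
Qed.

Lemma elem0 i j : elem i j (0 : K) = 1.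
Proof. by rewrite /elem scale0r addr0. Qed.

Lemma elemNK i j u M : i != j -> elem i j (- u) * (elem i j u * M) = M.
Proof. by move=> ij; rewrite mulrA elemD// addNr elem0 mul1r. Qed.

Lemma elemKN i j u M : i != j -> (M * elem i j u) * elem i j (- u) = M.
Proof. by move=> ij; rewrite -mulrA elemD// subrr elem0 mulr1. Qed.

Lemma det_elem i j u : i != j -> \det (elem i j u) = 1.
Proof.
move=> ij; wlog lij : i j ij / (j < i)%N.
  move=> h; case: (ltngtP i j) => [lij|lji|/val_inj e]; last by rewrite e eqxx in ij.
  - rewrite -det_tr -(h j i) 1?eq_sym//; congr (\det _).
    by apply/matrixP => a b; rewrite mxE !elemE eq_sym andbC.
  - exact: h.
rewrite det_trig.
  rewrite big1// => k _; rewrite elemE eqxx; case: (k =P i) => [->|]//=.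
    by rewrite (negPf ij) mulr0 addr0.
  by rewrite mulr0 addr0.
apply/is_trig_mxP => a b ab; rewrite elemE.
case: eqP => [e|_]; first by rewrite e ltnn in ab.
rewrite add0r; case: andP => [[/eqP e1 /eqP e2]|]; last by rewrite mulr0.
by move: lij; rewrite -e1 -e2 ltnNge (ltnW ab).
Qed.

End Elementary.

Section Elimination.
Variables (R : realType) (K : fieldType) (v : K -> \bar R) (n : nat).
Hypothesis hv : nonarch_local_field v.
Local Notation abs := (absv v).
Implicit Types (r : 'I_n.+1 -> R) (M : 'M[K]_n.+1).

(* With [N_r w = max_i (r i * |w i|)], this says [N_r (M w) <= c * N_r' w]. *)
Definition weight_le r r' (c : R) M :=
  forall i j, r i * abs (M i j) <= c * r' j.

Lemma weight_le1 r : (forall i, 0 <= r i) -> weight_le r r 1 1.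
Proof.
move=> r0 i j; rewrite mxE mul1r; case: eqP => [->|_].
  by rewrite absv1 ?mulr1.
by rewrite absv0 ?mulr0.
Qed.

Lemma weight_leM r r' r'' c c' M M' : 0 <= c -> 0 <= c' ->
  (forall i, 0 <= r i) -> (forall i, 0 <= r'' i) ->
  weight_le r r' c M -> weight_le r' r'' c' M' -> weight_le r r'' (c * c') (M * M').
Proof.
move=> c0 c'0 r0 r''0 h h' i j.
have rhs0 : 0 <= c * c' * r'' j by rewrite !mulr_ge0.
have := r0 i; rewrite le_eqVlt => /orP[/eqP <-|ri]; first by rewrite mul0r.
rewrite mulrC -ler_pdivlMr// mxE; apply: absv_sum => //.
  by rewrite divr_ge0// ltW.
move=> k _; rewrite absvM// ler_pdivlMr// mulrC mulrA.
apply: (@le_trans _ _ (c * r' k * abs (M' k j))).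
  by apply: ler_wpM2r; rewrite ?absv_ge0.
by rewrite -!mulrA; apply: ler_wpM2l.
Qed.

Lemma weight_le_elem r i j e : (forall k, 0 <= r k) -> i != j ->
  r i * abs e <= r j -> weight_le r r 1 (elem i j e).
Proof.
move=> r0 ij h a b; rewrite elemE mul1r.
case: andP => [[/eqP -> /eqP ->]|_]; first by rewrite (negPf ij) add0r mulr1.
rewrite mulr0 addr0; case: eqP => [->|_]; first by rewrite absv1 ?mulr1.
by rewrite absv0 mulr0.
Qed.

(** If every term of the Leibniz formula had absolute value below 1, so would the determinant, by
    the ultrametric inequality. *)
Lemma exists_perm M : 1 <= abs (\det M) ->
  exists s : {perm 'I_n.+1}, 1 <= \prod_i abs (M i (s i)).
Proof.
move=> h; apply: contrapT => /forallNP H; move: h; apply/negP; rewrite -ltNge.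
apply: absv_sum_lt => // s _; rewrite absv_sign// absv_prod//.
by rewrite ltNge; apply/negP; exact: H.
Qed.

Lemma perm_prod r (s : {perm 'I_n.+1}) : \prod_i r (s i) = \prod_i r i.
Proof. by rewrite [RHS](reindex_inj (@perm_inj _ s)). Qed.

Lemma weight_le_prod r r' M : (forall i, 0 < r i) ->
  weight_le r r' 1 M -> 1 <= abs (\det M) -> \prod_i r i <= \prod_i r' i.
Proof.
move=> r0 h /exists_perm [s hs].
rewrite -(perm_prod r' s) -[X in X <= _]mulr1.
apply: le_trans (_ : (\prod_i r i) * \prod_i abs (M i (s i)) <= _).
  by apply: ler_wpM2l => //; apply: prodr_ge0 => i _; exact: ltW.
rewrite -big_split /=; apply: ler_prod => i _.
by rewrite mulr_ge0 ?absv_ge0 ?(ltW (r0 i))//= (le_trans (h _ _))// mul1r.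
Qed.

(** Along the permutation of [exists_perm] each r_i |M i (s i)| is at most r_(s i), while both sides
    have comparable products; [prod_squeeze] gives equality. The entries found here serve as
    substitute pivots. *)
Lemma tight_perm r M : (forall i, 0 < r i) -> weight_le r r 1 M ->
  1 <= abs (\det M) -> exists s : {perm 'I_n.+1}, forall i, r i * abs (M i (s i)) = r (s i).
Proof.
move=> r0 h /exists_perm [s hs]; exists s; apply: prod_squeeze => // [i|].
  by rewrite mulr_ge0 ?absv_ge0 ?(ltW (r0 i))//= (le_trans (h _ _))// mul1r.
rewrite perm_prod big_split /= -[X in X <= _]mulr1.
by apply: ler_wpM2l => //; apply: prodr_ge0 => i _; exact: ltW.
Qed.

Definition integral_mx M := forall i j, abs (M i j) <= 1.

(** Integrality forces |M i (s i)| = 1 along a permutation, whence r_i <= r'_(s i). The matrix M'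
    supplies the opposite inequality between the products of the weights, so all these inequalities
    are equalities. *)
Lemma matching_perm r r' M M' : (forall i, 0 < r i) -> (forall i, 0 < r' i) ->
  integral_mx M -> abs (\det M) = 1 -> abs (\det M') = 1 ->
  weight_le r r' 1 M -> weight_le r' r 1 M' ->
  exists s : {perm 'I_n.+1}, forall i, r i = r' (s i).
Proof.
move=> r0 r'0 iM dM dM' h h'.
have p' : \prod_i r' i <= \prod_i r i by apply: (weight_le_prod r'0 h'); rewrite dM'.
have /exists_perm [s hs] : 1 <= abs (\det M) by rewrite dM.
have u : forall i, abs (M i (s i)) = 1.
  apply: (prod_squeeze (b := fun=> 1)) => // [i|]; last by rewrite big1.
  by rewrite absv_ge0 iM.
exists s; apply: prod_squeeze => // [i|]; last by rewrite perm_prod.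
by rewrite ltW//=; have := h i (s i); rewrite u mulr1 mul1r.
Qed.

Variables (r : 'I_n.+1 -> R) (F : 'I_n.+1 -> 'I_n.+1 -> \bar R).
Hypothesis r_gt0 : forall i, 0 < r i.
Hypothesis rF : forall i j e, r i * abs e <= r j -> (F i j <= v e)%E.

(** [F] stands for [fx] at a point with weights proportional to r, at the origin or at a general
    interior point. Only [rF] is asked of it: transvections preserving the weighted norm are
    available as generators. *)
Let Stab M := weight_le r r 1 M /\ abs (\det M) = 1.
Let Factored M := exists u t, [/\ Ugen v F u, forall k, abs (t k) = 1 & M = u * mono 1 t].

Lemma mono1E (t : 'I_n.+1 -> K) : mono 1 t = diag_mx (\row_k t k).
Proof.
apply/matrixP => a b; rewrite !mxE perm1; case: eqP => [->|_]; first by rewrite mulr1n.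
by rewrite mulr0n.
Qed.

Lemma mono1_elem (t : 'I_n.+1 -> K) i j e : t j != 0 ->
  mono 1 t * elem i j e = elem i j (t i * e / t j) * mono 1 t.
Proof.
move=> tj; apply/matrixP => a b; rewrite elem_mulr elem_mull mono1E !mxE.
congr (_ + _); rewrite (eq_sym b).
case: (a =P i) => [->|/eqP ai]; case: (j =P b) => _;
  rewrite ?mulr0n ?mulr1n ?mul0r ?mulr0 ?mul1r ?mulr1 ?eqxx//.
by rewrite mulfVK// mulrC.
Qed.

Lemma Ugen1 : Ugen v F 1.
Proof. by exists [::]; rewrite big_nil. Qed.

Lemma UgenM u w : Ugen v F u -> Ugen v F w -> Ugen v F (u * w).
Proof.
move=> [s [hs ->]] [s' [hs' ->]]; exists (s ++ s').
by rewrite all_cat hs hs' big_cat.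
Qed.

Lemma Ugen_elem i j e : i != j -> r i * abs e <= r j -> Ugen v F (elem i j e).
Proof.
by move=> ij h; exists [:: (i, j, e)]; rewrite /= ij rF// big_seq1.
Qed.

Lemma Stab_elemL i j e M : i != j -> r i * abs e <= r j -> Stab M ->
  Stab (elem i j e * M).
Proof.
move=> ij h [wM dM]; split; last by rewrite det_mulmx det_elem// mul1r.
by rewrite -[1]mulr1; apply: weight_leM wM => // *;
  [exact: ltW|exact: ltW|apply: weight_le_elem => // k; exact: ltW].
Qed.

Lemma Stab_elemR i j e M : i != j -> r i * abs e <= r j -> Stab M ->
  Stab (M * elem i j e).
Proof.
move=> ij h [wM dM]; split; last by rewrite det_mulmx det_elem// mulr1.
rewrite -[1]mulr1; apply: weight_leM wM _ => // *; try exact: ltW.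
by apply: weight_le_elem => // k; exact: ltW.
Qed.

Lemma Fact_elemL i j e M : i != j -> r i * abs e <= r j ->
  Factored (elem i j e * M) -> Factored M.
Proof.
move=> ij h [u [t [hu ht hM]]].
exists (elem i j (- e) * u), t; split=> //.
  by apply: UgenM => //; apply: Ugen_elem => //; rewrite absvN.
by rewrite -mulrA -hM elemNK.
Qed.

(** Undoing a column operation puts an elementary matrix to the right of the diagonal factor. Moving
    it to the left multiplies its parameter by t i / t j, a unit, so it still satisfies the bound
    required of a generator. *)
Lemma Fact_elemR i j e M : i != j -> r i * abs e <= r j ->
  Factored (M * elem i j e) -> Factored M.
Proof.
move=> ij h [u [t [hu ht hM]]].
exists (u * elem i j (t i * - e / t j)), t; split=> //.
  apply: UgenM => //; apply: Ugen_elem => //.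
  by rewrite !absvM// absvN// absv_inv1// mulr1 ht mul1r.
have tj : t j != 0 by rewrite -(absv_gt0 v) ht.
by rewrite -mulrA -mono1_elem// mulrA -hM elemKN.
Qed.

(** Row k is not in s, so it stays unchanged while its multiples are added one row at a time; hence
    the closed formula for the result. *)
Lemma row_ops k (c : 'I_n.+1 -> K) M (s : seq 'I_n.+1) : uniq s -> k \notin s ->
  (forall a, r a * abs (c a) <= r k) -> Stab M ->
  let M' := \matrix_(a, b) (M a b + (a \in s)%:R * (c a * M k b)) in
  Stab M' /\ (Factored M' -> Factored M).
Proof.
move=> us ks hc SM; elim: s us ks => [_ _|i s IH /= /andP[nis us]].
  suff -> /= : \matrix_(a, b) (M a b + (a \in [::])%:R * (c a * M k b)) = M by [].
  by apply/matrixP => a b; rewrite mxE mul0r addr0.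
rewrite inE negb_or => /andP[ki nks]; have {IH} [SI FI] := IH us nks.
set M' := \matrix_(a, b) _ in SI FI *.
suff -> : \matrix_(a, b) (M a b + (a \in i :: s)%:R * (c a * M k b)) =
    elem i k (c i) * M'.
  split; first by apply: Stab_elemL => //; rewrite eq_sym.
  by move=> /Fact_elemL-/(_ _ _)/FI; apply=> //; rewrite eq_sym.
apply/matrixP => a b; rewrite elem_mull !mxE inE (negPf nks) mul0r addr0.
case: (a =P i) => [->|_] /=; last by rewrite mul0r addr0.
by rewrite (negPf nis) mul0r addr0.
Qed.

Lemma col_ops k (c : 'I_n.+1 -> K) M (s : seq 'I_n.+1) : uniq s -> k \notin s ->
  (forall a, r k * abs (c a) <= r a) -> Stab M ->
  let M' := \matrix_(a, b) (M a b + (b \in s)%:R * (c b * M a k)) in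
  Stab M' /\ (Factored M' -> Factored M).
Proof.
move=> us ks hc SM; elim: s us ks => [_ _|i s IH /= /andP[nis us]].
  suff -> /= : \matrix_(a, b) (M a b + (b \in [::])%:R * (c b * M a k)) = M by [].
  by apply/matrixP => a b; rewrite mxE mul0r addr0.
rewrite inE negb_or => /andP[ki nks]; have {IH} [SI FI] := IH us nks.
set M' := \matrix_(a, b) _ in SI FI *.
suff -> : \matrix_(a, b) (M a b + (b \in i :: s)%:R * (c b * M a k)) =
    M' * elem k i (c i).
  split; first by apply: Stab_elemR.
  by move=> /Fact_elemR-/(_ _ _)/FI; apply.
apply/matrixP => a b; rewrite elem_mulr !mxE inE (negPf nks) mul0r addr0.
case: (b =P i) => [->|_] /=; last by rewrite mul0r addr0.
by rewrite (negPf nis) mul0r addr0.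
Qed.

Let cleared (k : nat) M :=
  forall i j : 'I_n.+1, i != j -> (i < k)%N || (j < k)%N -> M i j = 0.

Lemma absv_unit_add (x : K) : abs x < 1 -> abs (x + 1) = 1.
Proof.
move=> x1; have le1 : abs (x + 1) <= 1.
  by apply: absvD => //; [exact: ltW|rewrite absv1].
apply/le_anti; rewrite le1 leNgt; apply/negP => h.
have : abs ((x + 1) + (- x)) < 1 by apply: absvD_lt; rewrite ?absvN.
by rewrite addrC addKr absv1 ?ltxx.
Qed.

(** With a unit pivot the multipliers have the same absolute values as the entries to be cleared, so
    the weight bound on M is exactly what makes these operations admissible. *)
Lemma clear_pivot (k : 'I_n.+1) M : Stab M -> cleared k M -> abs (M k k) = 1 ->
  (forall M', Stab M' -> cleared k.+1 M' -> Factored M') -> Factored M.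
Proof.
move=> SM cM pk IH; have pk0 : M k k != 0 by rewrite -(absv_gt0 v) pk.
pose s := rem k (enum 'I_n.+1).
have us : uniq s by rewrite rem_uniq ?enum_uniq.
have sE a : (a \in s) = (a != k).
  by rewrite mem_rem_uniq ?enum_uniq// inE mem_enum andbT.
have ks : k \notin s by rewrite sE eqxx.
have [wM dM] := SM.
have nc x : abs (- x / M k k) = abs x by rewrite absvM// absvN// absv_inv1// mulr1.
have [|SM1 FM1] := @row_ops k (fun a => - M a k / M k k) M s us ks _ SM.
  by move=> a; rewrite nc; have := wM a k; rewrite mul1r.
set M1 := \matrix_(a, b) _ in SM1 FM1.
have [|SM2 FM2] := @col_ops k (fun b => - M k b / M k k) M1 s us ks _ SM1.
  by move=> a; rewrite nc; have := wM k a; rewrite mul1r.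
set M2 := \matrix_(a, b) _ in SM2 FM2.
apply/FM1/FM2/IH => // i j ij lij; rewrite /M2 /M1 !mxE !sE.
have [ik|ik] := eqVneq i k; have [jk|jk] := eqVneq j k.
- by rewrite ik jk eqxx in ij.
- by subst i; rewrite /= !mul0r !addr0 mul1r mulfVK// subrr.
- by subst j; rewrite /= mul1r mul0r addr0 mulfVK// subrr.
(* Away from row and column k the two operations change M i j by a multiple of M i k * M k j, so the
   zeros of earlier pivots survive. *)
have e : M i k * M k j = 0 /\ M i j = 0.
  have lt (a : 'I_n.+1) : a != k -> (a < k.+1)%N -> (a < k)%N.
    move=> ak; rewrite ltnS leq_eqVlt => /orP[/eqP/val_inj e|//].
    by rewrite e eqxx in ak.
  case/orP: lij => [/(lt _ ik) l|/(lt _ jk) l].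
  - by rewrite (cM i k ik) ?l// mul0r (cM i j ij) ?l.
  - have kj : k != j by rewrite eq_sym.
    have -> : M k j = 0 by apply: cM => //; rewrite l orbT.
    by rewrite mulr0; split=> //; apply: cM => //; rewrite l orbT.
have [e1 e2] := e; rewrite /= e2 !mul1r !mulNr.
have -> : M i k / M k k * M k j = 0 by rewrite mulrAC e1 mul0r.
have -> : M i k / M k k * M k k = M i k by rewrite mulfVK.
by rewrite !(subrr, mulr0, oppr0, addr0).
Qed.

(** A pivot with |M k k| < 1 cannot be repaired by a row swap, which need not preserve the weights.
    Instead [tight_perm] gives a row i with r_i |M i k| = r_k; adding (M i k)^-1 times this row to
    row k is admissible and turns the pivot into M k k + 1, a unit. Row i differs from k by the size
    of the pivot, and i > k since earlier rows vanish in column k. At the end M is diagonal with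
    entries of absolute value at most 1 and product of absolute value 1, so all are units. *)
Lemma eliminate_from (p k : nat) M : (k + p)%N = n.+1 -> Stab M -> cleared k M -> Factored M.
Proof.
elim: p k M => [k M|p IH k M kp SM cM].
  rewrite addn0 => -> [wM dM] cM.
  have ME : M = mono 1 (fun k => M k k).
    apply/matrixP => a b; rewrite mono1E !mxE; case: (a =P b) => [->|/eqP ab].
      by rewrite mulr1n.
    by rewrite mulr0n cM// ltn_ord.
  exists 1, (fun k => M k k); split; rewrite ?mul1r//; first exact: Ugen1.
  apply: (prod_squeeze (b := fun=> 1)) => // [i|].
    by rewrite absv_ge0 -(ler_pM2l (r_gt0 i)) mulr1 (le_trans (wM i i))// mul1r.
  rewrite big1// -(absv_prod hv) -dM [in X in X <= _]ME mono1E det_diag.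
  by under eq_bigr do rewrite mxE.
have kn : (k < n.+1)%N by rewrite -kp addnS ltnS leq_addr.
pose k' := Ordinal kn; have [wM dM] := SM.
have next M' : Stab M' -> cleared k'.+1 M' -> Factored M'.
  by apply: IH; rewrite addSnnS.
have le1 : abs (M k' k') <= 1.
  by rewrite -(ler_pM2l (r_gt0 k')) mulr1 (le_trans (wM _ _))// mul1r.
move: le1; rewrite le_eqVlt => /orP[/eqP e|lt1]; first exact: (clear_pivot (k := k')).
have [|s hs] := tight_perm r_gt0 wM; first by rewrite dM.
pose i := (s^-1)%g k'; have := hs i; rewrite permKV => hi.
have Mi0 : M i k' != 0.
  by apply/eqP => e; move: hi (r_gt0 k'); rewrite e absv0 mulr0 => <-; rewrite ltxx.
have ik : i != k'.
  apply/eqP => e; move: hi; rewrite e => /eqP.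
  by rewrite -subr_eq0 -{2}[r k']mulr1 -mulrBr mulf_eq0 gt_eqF//= subr_eq0 lt_eqF.
have ki : k' != i by rewrite eq_sym.
have lki : (k <= i)%N.
  by rewrite leqNgt; apply/negP => l; move/eqP: Mi0; apply; apply: cM; rewrite ?l.
have hr : r k' * abs ((M i k')^-1) <= r i.
  by rewrite absvV// ler_pdivrMr ?absv_gt0// hi.
apply: (@Fact_elemL k' i (M i k')^-1) => //.
apply: (clear_pivot (k := k')) => //; first exact: Stab_elemL.
- move=> a b ab lab; rewrite elem_mull (cM a b)// add0r.
  case: (a =P k') => [e|_]; last by rewrite mul0r.
  have lb : (b < k)%N by move: lab; rewrite e ltnn.
  have ib : i != b by rewrite -val_eqE neq_ltn (leq_trans lb lki) orbT.
  by rewrite (cM i b ib) ?lb ?orbT// !mulr0.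
- by rewrite elem_mull eqxx mul1r mulVf// absv_unit_add.
Qed.

Lemma elimination M : weight_le r r 1 M -> abs (\det M) = 1 ->
  exists u t, [/\ Ugen v F u, forall k, abs (t k) = 1 & M = u * mono 1 t].
Proof.
by move=> wM dM; apply: (@eliminate_from n.+1 0).
Qed.

End Elimination.

(** * The compactified apartment as a space of weights *)

Lemma cvg_row (R : realType) (n : nat) (T : Type) (F : set_system T) {FF : Filter F}
    (f : T -> 'rV[R]_n) (r : 'rV[R]_n) :
  (forall i, (fun x => f x 0 i) @ F --> r 0 i) -> f @ F --> r.
Proof.
move=> h A [P hP PA].
have : \forall x \near F, forall i, P 0 i (f x 0 i).
  by apply: filter_forall => i; apply: h; exact: hP.
by apply: filterS => x Px; apply: PA => i j; rewrite (ord1 i).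
Qed.

Lemma cvg_apply (T : Type) (U V : topologicalType) (F : set_system T) {FF : Filter F}
    (h : U -> V) (f : T -> U) (a : U) :
  {for a, continuous h} -> f @ F --> a -> (fun x => h (f x)) @ F --> h a.
Proof. exact: continuous_cvg. Qed.

Lemma cvg_ext (T : Type) (U : topologicalType) (F : set_system T) (f g : T -> U) (a : U) :
  f =1 g -> g @ F --> a -> f @ F --> a.
Proof. by move=> /funext ->. Qed.

Lemma near_row (R : realType) (n : nat) (r : 'rV[R]_n) (P : 'I_n -> R -> Prop) :
  (forall i, \forall s \near (r 0 i : R), P i s) ->
  \forall r' \near r, forall i, P i ((r' : 'rV[R]_n) 0 i).
Proof.
move=> h; exists (fun _ => P) => [i j|r' hr' i]; last exact: hr'.
by rewrite (ord1 i); exact: h.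
Qed.

Section Subbase.
Variables (T : topologicalType) (D : set (set T)).
Hypothesis openD : open = [set \bigcup_(C in D') C | D' in subset^~ (finI_from D id)].

Lemma nbhs_subbase (x : T) (B : set T) : D B -> B x -> nbhs x B.
Proof.
move=> hB Bx; rewrite nbhsE; exists B => //; split=> //; rewrite openD.
exists [set B] => [C -> |]; last by rewrite bigcup_set1.
by apply: finI_from1.
Qed.

Lemma cvg_subbase (F : set_system T) (x : T) : Filter F ->
  (forall B, D B -> B x -> F B) -> F --> x.
Proof.
move=> FF h A; rewrite nbhsE => -[B []]; rewrite openD => -[D' sD' <-] [C D'C Cx] BA.
have [fs hfs eC] := sD' _ D'C; have FC : F C.
  rewrite -eC; apply: filter_bigI => B' B'fs; apply: h.
    by have := hfs _ B'fs; rewrite inE.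
  by move: Cx; rewrite -eC; apply.
by apply: filterS FC => y Cy; apply: BA; exists C.
Qed.

End Subbase.

Section ApartmentTopology.
Variables (R : realType) (n : nat).
Implicit Types (x : Abar R n) (r w : 'rV[R]_n.+1) (I J : {set 'I_n.+1}).

Lemma nbhs_Abar_base x (B : set (Abar R n)) : Abar_base B -> B x -> nbhs x B.
Proof. exact: nbhs_subbase. Qed.

Lemma cvg_Abar (F : set_system (Abar R n)) x : Filter F ->
  (forall B, Abar_base B -> B x -> F B) -> F --> x.
Proof. by move=> FF; apply: cvg_subbase. Qed.

(** [sI] picks the representative of sum zero modulo the line of constant vectors, which encodes the
    relation that the generators of A_I add up to 0. A common shift is therefore invisible. *)
Lemma eq_sI I w w' (c : R) : (forall i, i \in I -> w 0 i = w' 0 i + c) ->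
  sI I w = sI I w'.
Proof.
move=> h; apply/rowP => i; rewrite !mxE; case: ifP => // iI.
have I0 : #|I|%:R != 0 :> R by rewrite pnatr_eq0 -lt0n; apply/card_gt0P; exists i.
have -> : \sum_(j in I) w 0 j = \sum_(j in I) w' 0 j + c * #|I|%:R.
  rewrite (eq_bigr (fun j => w' 0 j + c)); last exact: h.
  by rewrite big_split /= sumr_const mulr_natr.
by rewrite h// mulrDl mulfK// opprD addrACA subrr addr0.
Qed.

Definition sIshift I w : R := (\sum_(j in I) w 0 j) / #|I|%:R.

Lemma sI_in I w i : i \in I -> sI I w 0 i = w 0 i - sIshift I w.
Proof. by move=> iI; rewrite mxE iI. Qed.

Lemma sI_eqP I w w' : sI I w = sI I w' ->
  exists c, forall i, i \in I -> w' 0 i = w 0 i + c.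
Proof.
move=> e; exists (sIshift I w' - sIshift I w) => i iI.
have := congr1 (fun z : 'rV_n.+1 => z 0 i) e; rewrite !sI_in// => h.
by apply/eqP; rewrite addrA -[w 0 i + _ - _]addrAC h subrK.
Qed.

Lemma sI_id I w : (forall i, i \notin I -> w 0 i = 0) ->
  \sum_(i in I) w 0 i = 0 -> sI I w = w.
Proof.
move=> h s0; apply/rowP => i; rewrite !mxE s0 mul0r subr0.
by case: ifPn => // /h ->.
Qed.

Lemma AbarP x : let p := abval x in
  [/\ p.1 != finset.set0, forall i, i \notin p.1 -> p.2 0 i = 0
    & \sum_(i in p.1) p.2 0 i = 0].
Proof.
case: x => p /= /and3P[h1 /forallP h2 /eqP h3]; split=> // i ip.
by have := h2 i; rewrite ip => /eqP.
Qed.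

Lemma sI_pred I w : I != finset.set0 -> Abar_pred (I, sI I w).
Proof.
move=> I0; apply/and3P; split=> //=.
  by apply/forallP => i; apply/implyP => /negPf iI; rewrite mxE iI.
have c0 : #|I|%:R != 0 :> R by rewrite pnatr_eq0 cards_eq0.
apply/eqP; rewrite (eq_bigr (fun i => w 0 i - sIshift I w)); last exact: sI_in.
by rewrite sumrB sumr_const -mulr_natr /sIshift mulfVK// subrr.
Qed.

Lemma abval_sI x : abval x = ((abval x).1, sI (abval x).1 (abval x).2).
Proof.
have [_ h1 h2] := AbarP x.
by rewrite sI_id//; case: (abval x).
Qed.

Lemma origin_pred : Abar_pred (origin R n).
Proof.
apply/and3P; split=> /=; first by apply/set0Pn; exists ord0.
  by apply/forallP => i; rewrite finset.in_setT.
by rewrite big1// => i _; rewrite mxE.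
Qed.

(* A point of the apartment is encoded by the weights exp(- x_i) of the
   corresponding diagonal seminorm, defined up to a common factor; the
   weight is 0 in the directions outside the support. *)
Definition weight x : 'rV[R]_n.+1 :=
  \row_i (if i \in (abval x).1 then expR (- (abval x).2 0 i) else 0).

Definition supp r : {set 'I_n.+1} := [set i | r 0 i != 0]%SET.

(** The absolute value lets [of_weight] make sense on every nonzero vector, so compactness can be
    drawn from the full sphere of the sup norm. Values at zero coordinates are discarded by
    [sI (supp r)]. *)
Definition lg r : 'rV[R]_n.+1 := \row_i - ln `|r 0 i|.

Lemma lgE r i : lg r 0 i = - ln `|r 0 i|.
Proof. by rewrite mxE. Qed.

(** The default, the origin, is taken only for r = 0, where the support is empty. *)
Definition of_weight r : Abar R n :=
  insubd (MkAbar origin_pred) (supp r, sI (supp r) (lg r)).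

Lemma supp_neq0 r : r != 0 -> supp r != finset.set0.
Proof.
apply: contra_neq => e; apply/rowP => i; rewrite mxE.
by have := finset.in_set0 i; rewrite -e inE => /negbFE/eqP.
Qed.

Lemma abval_of_weight r : r != 0 ->
  abval (of_weight r) = (supp r, sI (supp r) (lg r)).
Proof. by move=> r0; rewrite [LHS]insubdK//; exact/sI_pred/supp_neq0. Qed.

Lemma of_weight_scale r r' (c : R) : 0 < c -> r != 0 ->
  (forall i, `|r' 0 i| = c * `|r 0 i|) -> of_weight r' = of_weight r.
Proof.
move=> c0 r0 h.
have e i : (r' 0 i != 0) = (r 0 i != 0).
  by rewrite -normr_eq0 h mulf_eq0 gt_eqF//= normr_eq0.
have r'0 : r' != 0.
  have /set0Pn[i] := supp_neq0 r0; rewrite inE -e.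
  by apply: contraNneq => ->; rewrite mxE.
apply: val_inj; rewrite /= !abval_of_weight//.
have -> : supp r' = supp r by apply/setP => i; rewrite !inE e.
congr pair; apply: (@eq_sI _ _ _ (- ln c)) => i; rewrite inE => ri.
by rewrite !mxE h lnM ?posrE ?normr_gt0// opprD addrC.
Qed.

Lemma weight_ge0 x i : 0 <= weight x 0 i.
Proof. by rewrite mxE; case: ifP => // _; exact: expR_ge0. Qed.

Lemma weight_eq0 x i : (weight x 0 i == 0) = (i \notin (abval x).1).
Proof. by rewrite mxE; case: ifP => _; rewrite ?eqxx// gt_eqF// expR_gt0. Qed.

Lemma weight_neq0 x : weight x != 0.
Proof.
have [/set0Pn[i xi] _ _] := AbarP x.
apply/eqP => e; have := weight_eq0 x i; rewrite xi e mxE eqxx.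
by [].
Qed.

Lemma supp_weight x : supp (weight x) = (abval x).1.
Proof. by apply/setP => i; rewrite inE weight_eq0 negbK. Qed.

Lemma weight_sI x J w : abval x = (J, sI J w) ->
  exists2 c, 0 < c & forall i, weight x 0 i = c * (if i \in J then expR (- w 0 i) else 0).
Proof.
move=> e; exists (expR (sIshift J w)); first exact: expR_gt0.
move=> i; rewrite mxE e /=; case: ifP => iJ; last by rewrite mulr0.
by rewrite sI_in// -expRD opprB.
Qed.

Lemma of_weightK x : of_weight (weight x) = x.
Proof.
apply: val_inj; rewrite /= abval_of_weight ?weight_neq0// supp_weight [RHS]abval_sI.
congr pair; apply: (@eq_sI _ _ _ 0) => i xi.
by rewrite !mxE xi addr0 ger0_norm ?expR_ge0// expRK opprK.
Qed.

Lemma weight_of_weight r : r != 0 ->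
  exists2 c, 0 < c & forall i, weight (of_weight r) 0 i = c * `|r 0 i|.
Proof.
move=> r0; have [c c0 h] := weight_sI (abval_of_weight r0).
exists c => // i; rewrite h inE; case: eqP => [->|/eqP ri]; first by rewrite normr0.
by rewrite mxE opprK lnK// posrE normr_gt0.
Qed.

Lemma cvg_coord (T : Type) (F : set_system T) {FF : Filter F} (f : T -> 'rV[R]_n.+1) r i :
  f @ F --> r -> (fun y => f y 0 i) @ F --> r 0 i.
Proof.
move=> fr; apply: (cvg_apply (h := fun r' : 'rV[R]_n.+1 => r' 0 i)) fr.
exact: coord_continuous.
Qed.

Lemma cvg_lg (F : set_system 'rV[R]_n.+1) {FF : Filter F} r i : r 0 i != 0 ->
  F --> r -> (fun r' => lg r' 0 i) @ F --> lg r 0 i.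
Proof.
move=> ri Fr; rewrite lgE; apply: (cvg_ext (lgE^~ i)).
apply: cvgN; apply: (cvg_apply (h := @ln R)).
  by apply: continuous_ln; rewrite normr_gt0.
by apply: cvg_norm; exact: cvg_coord.
Qed.

Lemma near_coord_neq0 (F : set_system 'rV[R]_n.+1) {FF : Filter F} r i :
  F --> r -> r 0 i != 0 -> \forall r' \near F, (r' : 'rV[R]_n.+1) 0 i != 0.
Proof.
move=> Fr ri.
have h : (fun r' : 'rV[R]_n.+1 => r' 0 i) @ F --> r 0 i by exact: cvg_coord.
apply: (h [set y | y != 0]).
exact: open_nbhs_nbhs (conj (@open_neq _ 0) ri).
Qed.

Lemma near_supp (F : set_system 'rV[R]_n.+1) {FF : Filter F} r I :
  F --> r -> I \subset supp r -> \forall r' \near F, I \subset supp r'.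
Proof.
move=> Fr /fintype.subsetP h.
have : \forall r' \near F, forall i, i \in I -> (r' : 'rV[R]_n.+1) 0 i != 0.
  apply: filter_forall => i; case: (boolP (i \in I)) => iI; last exact: nearW.
  by have := h _ iI; rewrite inE => /(near_coord_neq0 Fr); apply: filterS.
by apply: filterS => r' hr'; apply/fintype.subsetP => i iI; rewrite inE hr'.
Qed.

Lemma neq0_supp r I : I != finset.set0 -> I \subset supp r -> r != 0.
Proof.
move=> /set0Pn[i iI] /fintype.subsetP/(_ _ iI); rewrite inE.
by apply: contraNneq => ->; rewrite mxE.
Qed.

(** For a set [Gamma I W], coordinates in I have nonzero limits and their logarithms converge. A
    coordinate outside I is only bounded above near r, possibly tending to 0 or vanishing; this is a
    lower bound on the logarithm, and the excess is absorbed by the nonnegative vector t, or the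
    coordinate leaves the support. *)
Lemma cvg_of_weight (F : set_system 'rV[R]_n.+1) {FF : Filter F} r : r != 0 ->
  F --> r -> of_weight @ F --> of_weight r.
Proof.
move=> r0 Fr; apply: cvg_Abar => B [[V oV ->]|[I [W [I0 IT oW bW ->]]]].
  move=> [w Vw]; rewrite abval_of_weight//; case=> sr.
  rewrite sr => /sI_eqP [c hc].
  pose G r' := lg r' + const_mx c.
  have GV : \forall r' \near F, V (G r').
    have : G @ F --> w.
      apply: cvg_row => i; rewrite hc ?finset.in_setT//.
      have GE r' : G r' 0 i = lg r' 0 i + c by rewrite !mxE.
      apply: (cvg_ext GE).
      apply: cvgD; last exact: cvg_cst.
      apply: cvg_lg => //.
      by have := finset.in_setT i; rewrite -sr inE.
    by apply; exact: open_nbhs_nbhs.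
  have sT : \forall r' \near F, [set: 'I_n.+1]%SET \subset supp r'.
    by apply: (near_supp Fr); rewrite sr.
  suff : \forall r' \near F, A_basic V (of_weight r') by [].
  near=> r'; have s' : [set: 'I_n.+1]%SET \subset supp r' by near: r'.
  have r'0 : r' != 0.
    by apply: neq0_supp s'; apply/set0Pn; exists ord0.
  exists (G r'); first by near: r'.
  rewrite abval_of_weight//.
  have -> : supp r' = [set: 'I_n.+1]%SET by apply/eqP; rewrite -finset.subTset.
  congr pair; apply: (@eq_sI _ _ _ (- c)) => i _.
  by rewrite [G r' _ _]mxE [const_mx _ _ _]mxE addrK.
move=> [J [IJ [w Ww [t [t0 [tI]]]]]]; rewrite abval_of_weight//; case=> sr.
rewrite sr => /sI_eqP [c hc].
have [e e0 We] : exists2 e : R, 0 < e & forall w', (forall i, `|w 0 i - w' 0 i| < e) -> W w'.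
  have /nbhs_ballP [e e0 he] : nbhs w W by exact: open_nbhs_nbhs.
  exists e => // w' hw'; apply: he; split => // i j.
  by rewrite (ord1 i); exact: hw'.
(* The slack d is needed where t_i = 0: there |r_i| is exactly exp(c - w_i), and nearby vectors may
   exceed it. Lowering the base point to w_i - d makes the bound strict, and d < e keeps it in W. *)
pose d := e / 2; have d0 : 0 < d by rewrite divr_gt0.
pose w' r' : 'rV[R]_n.+1 := \row_i (if i \in I then lg r' 0 i + c else w 0 i - d).
have n1 : \forall r' \near F, forall i, i \in I -> `|w 0 i - (lg r' 0 i + c)| < e.
  apply: filter_forall => i; case: (boolP (i \in I)) => iI; last exact: nearW.
  have iJ : i \in J by apply: (fintype.subsetP IJ).
  have h : (fun r' => lg r' 0 i + c) @ F --> w 0 i.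
    have -> : w 0 i = lg r 0 i + c by rewrite -hc// mxE tI ?addr0.
    apply: cvgD; last exact: cvg_cst.
    by apply: cvg_lg => //; move: iJ; rewrite -sr inE.
  by apply: filterS (cvgr_dist_lt _ _ h _ e0) => r'.
have n2 : \forall r' \near F, forall i, i \notin I ->
    `|(r' : 'rV[R]_n.+1) 0 i| <= expR (c - (w 0 i - d)).
  apply: filter_forall => i; case: (boolP (i \in I)) => iI; first exact: nearW.
  have h : (fun r' : 'rV[R]_n.+1 => `|r' 0 i|) @ F --> `|r 0 i|.
    by apply: cvg_norm; exact: cvg_coord.
  have lt : `|r 0 i| < expR (c - (w 0 i - d)).
    case: (boolP (i \in J)) => iJ; last first.
      by move: iJ; rewrite -sr inE negbK => /eqP ->; rewrite normr0 expR_gt0.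
    rewrite -[`|_|]lnK ?posrE ?normr_gt0; last by move: iJ; rewrite -sr inE.
    rewrite ltr_expR; have := hc _ iJ; rewrite !mxE; have := t0 i; lra.
  by apply: filterS (cvgr_le _ h _ lt) => r'.
have n3 : \forall r' \near F, I \subset supp r' by apply: (near_supp Fr); rewrite sr.
suff : \forall r' \near F, Gamma I W (of_weight r') by [].
near=> r'.
have m3 : I \subset supp r' by near: r'.
have m1 : forall i, i \in I -> `|w 0 i - (lg r' 0 i + c)| < e by near: r'.
have m2 : forall i, i \notin I -> `|r' 0 i| <= expR (c - (w 0 i - d)) by near: r'.
have r'0 := neq0_supp I0 m3.
exists (supp r'); split=> //; exists (w' r').
  apply: We => i; rewrite mxE; case: ifP => iI; first exact: m1.
  by rewrite subKr gtr0_norm// /d; lra.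
exists (\row_i (if i \in I then 0 else if r' 0 i == 0 then 0 else lg r' 0 i + c - (w 0 i - d))).
split => [i|].
  rewrite mxE; case: ifPn => // iI; case: eqVneq => // ri.
  have := m2 _ iI; rewrite -ler_ln ?posrE ?normr_gt0 ?expR_gt0// expRK mxE; lra.
split => [i iI|]; first by rewrite mxE iI.
rewrite abval_of_weight//; congr pair.
apply: (@eq_sI _ _ _ (- c)) => i; rewrite inE => ri.
rewrite !mxE (negPf ri).
by case: ifP => _; lra.
Unshelve. all: by end_near. Qed.

Lemma continuous_of_weight r : r != 0 -> {for r, continuous of_weight}.
Proof. move=> r0; have := @cvg_of_weight (nbhs r) _ r r0; apply. exact: cvg_id. Qed.

Definition nweight x : 'rV[R]_n.+1 := `|weight x|^-1 *: weight x.

Lemma norm_weight_gt0 x : 0 < `|weight x|.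
Proof. by rewrite normr_gt0 weight_neq0. Qed.

Lemma norm_nweight x : `|nweight x| = 1.
Proof.
rewrite /nweight normrZ ger0_norm ?invr_ge0 ?normr_ge0// mulVf//.
by rewrite gt_eqF// norm_weight_gt0.
Qed.

Lemma weight_nweight x i : weight x 0 i = `|weight x| * nweight x 0 i.
Proof. by rewrite /nweight [in RHS]mxE mulVKf// gt_eqF// norm_weight_gt0. Qed.

Lemma nweight_ge0 x i : 0 <= nweight x 0 i.
Proof. by rewrite mxE mulr_ge0 ?weight_ge0// invr_ge0 normr_ge0. Qed.

Lemma of_nweight x : of_weight (nweight x) = x.
Proof.
rewrite -[RHS]of_weightK; apply: (@of_weight_scale _ _ `|weight x|^-1).
- by rewrite invr_gt0 norm_weight_gt0.
- exact: weight_neq0.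
- by move=> i; rewrite mxE normrM ger0_norm// invr_ge0 normr_ge0.
Qed.

Lemma nweight_le1 x i : nweight x 0 i <= 1.
Proof.
rewrite -(norm_nweight x); apply: le_trans (ler_norm _) _.
have := mx_normrE (nweight x) => /= h.
rewrite [X in _ <= X]h.
by apply: (le_bigmax _ (fun ij : 'I_1 * 'I_n.+1 => `|nweight x ij.1 ij.2|) (0, i)).
Qed.

Lemma nweight_eq1 x : exists i, nweight x 0 i = 1.
Proof.
have e : mx_norm (nweight x) = 1 := norm_nweight x.
have /mx_norm_neq0 [[i j]] : mx_norm (nweight x) != 0 by rewrite e oner_eq0.
rewrite e /= (ord1 i) => h.
by exists j; rewrite -[LHS]ger0_norm ?nweight_ge0.
Qed.

(** Normalization is insensitive to scaling, so it is enough to control unnormalized weights on one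
    basic neighbourhood of x: [A_basic] inside the apartment, [Gamma] with the support of x as index
    set on the boundary. *)
Lemma continuous_nweight : continuous nweight.
Proof.
move=> x; pose N (r : 'rV[R]_n.+1) := `|r|^-1 *: r.
have cN (F : set_system 'rV[R]_n.+1) (FF : Filter F) : F --> weight x -> N @ F --> N (weight x).
  move=> Fx; apply: cvgZ => //.
  apply: (cvg_apply (h := @GRing.inv R)).
    by apply: inv_continuous; rewrite gt_eqF// norm_weight_gt0.
  exact: cvg_norm.
have Nscale (c : R) r : 0 < c -> N (c *: r) = N r.
  move=> c0; rewrite /N normrZ gtr0_norm// invfM scalerA mulrAC mulVf ?gt_eqF//.
  by rewrite mul1r.
move=> U nU; have /nbhs_ballP [e e0 he] : nbhs (weight x) (N @^-1` U).
  by have := cN (nbhs (weight x)) _; apply=> //; exact: cvg_id.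
pose O := [set w : 'rV[R]_n.+1 | forall i, `|weight x 0 i - expR (- w 0 i)| < e].
have oO : open O.
  rewrite openE => w Ow.
  apply: (@near_row _ _ w (fun i s => `|weight x 0 i - expR (- s)| < e)) => i.
  have h (F : set_system R) (FF : Filter F) : F --> w 0 i ->
      (fun s : R => `|weight x 0 i - expR (- s)|) @ F --> `|weight x 0 i - expR (- w 0 i)|.
    move=> Fw; apply: cvg_norm; apply: cvgB; first exact: cvg_cst.
    apply: (cvg_apply (h := @expR R)); first exact: continuous_expR.
    exact: cvgN.
  by apply: (cvgr_lt _ (h _ _ cvg_id) _ (Ow i)).
have key y J w : abval y = (J, sI J w) ->
    (forall i, `|weight x 0 i - (if i \in J then expR (- w 0 i) else 0)| < e) ->
    U (nweight y).
  move=> /weight_sI [c c0 hc] hw.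
  have -> : nweight y = N (\row_i (if i \in J then expR (- w 0 i) else 0)).
    rewrite -(Nscale _ _ c0) /nweight /N;
    suff -> : weight y = c *: \row_i (if i \in J then expR (- w 0 i) else 0) by [].
    by apply/rowP => i; rewrite !mxE -hc mxE.
  apply: he; split=> // i j; rewrite (ord1 i) [X in ball _ _ X]mxE.
  exact: hw.
have [h0 h1 h2] := AbarP x.
set J := (abval x).1 in h0 h1 h2 *; set z := (abval x).2 in h1 h2 *.
have [JT|JT] := eqVneq J [set: 'I_n.+1]%SET.
  have Bx : A_basic O x.
    exists z; last by rewrite abval_sI -/J JT.
    by move=> i; rewrite /weight mxE -/J JT finset.in_setT subrr normr0.
  have : nbhs x (A_basic O) by apply: nbhs_Abar_base => //; left; exists O.
  apply: filterS => y [w Ow ey]; apply: (key _ _ _ ey) => i.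
  by rewrite finset.in_setT; exact: Ow.
(* Outside J this value gives weight e * exp(- 1) < e; adding t >= 0 only lowers it and dropping the
   coordinate gives 0, so the whole of [Gamma J W] stays close to x. The unit ball makes W
   bounded. *)
pose w0 : 'rV[R]_n.+1 := \row_i (if i \in J then z 0 i else 1 - ln e).
pose W := O `&` ball w0 1.
have oW : open W by apply: openI => //; exact: ball_open.
have bW : bounded_set W.
  exists (`|w0| + 1); split; first by rewrite num_real.
  move=> M hM w [_]; rewrite mx_norm_ball /ball_ /= => hw.
  apply: ltW; apply: lt_trans hM.
  rewrite -ltrBlDl; apply: le_lt_trans hw; rewrite distrC.
  exact: lerB_dist.
have Bx : Gamma J W x.
  exists J; split=> //; exists w0.
    split; last exact: ballxx.
    move=> i; rewrite /weight !mxE -/J -/z; case: ifP => _; first by rewrite subrr normr0.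
    rewrite sub0r normrN gtr0_norm ?expR_gt0//.
    by rewrite -[ltRHS]lnK ?posrE// ltr_expR; lra.
  exists 0; split=> [i|]; first by rewrite mxE.
  split=> [i _|]; first by rewrite mxE.
  rewrite abval_sI -/J -/z; congr pair; apply: (@eq_sI _ _ _ 0) => i iJ.
  by rewrite !mxE iJ !addr0.
have : nbhs x (Gamma J W).
  by apply: nbhs_Abar_base => //; right; exists J, W; split.
apply: filterS => y [J' [JJ' [w [Ow _] [t [t0 [tJ ey]]]]]].
apply: (key _ _ _ ey) => i; have [iJ|iJ] := boolP (i \in J).
  by rewrite (fintype.subsetP JJ')// !mxE tJ// addr0; have := Ow i; rewrite mxE.
have := Ow i; have -> : weight x 0 i = 0 by apply/eqP; rewrite weight_eq0.
rewrite !sub0r !normrN; case: ifP => _; last by rewrite normr0.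
rewrite !ger0_norm ?expR_ge0//; apply: le_lt_trans.
by rewrite ler_expR lerN2 mxE lerDl t0.
Qed.

Lemma compact_Abar : compact [set: Abar R n].
Proof.
have -> : [set: Abar R n] = of_weight @` [set r | `|r| = 1].
  rewrite eqEsubset; split=> // x _; exists (nweight x); first exact: norm_nweight.
  exact: of_nweight.
apply: continuous_compact.
  apply: continuous_in_subspaceT => r; rewrite inE /= => r1.
  by apply: continuous_of_weight; rewrite -normr_gt0 r1.
apply: bounded_closed_compact.
  exists 1; split; first by rewrite num_real.
  by move=> M hM r /= ->; exact: ltW.
apply: (@closed_comp _ _ (@Num.norm R 'rV[R]_n.+1) [set x | x = 1]).
  by move=> r _; exact: norm_continuous.
exact: closed_eq.
Qed.

Definition truncate_weight (x : Abar R n) (s : R) : 'rV[R]_n.+1 :=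
  \row_i Num.max (nweight x 0 i) s.

Lemma truncate_weightE x s i :
  truncate_weight x s 0 i = Num.max (nweight x 0 i) s.
Proof. by rewrite mxE. Qed.

Lemma truncate_weight_neq0 x s : truncate_weight x s != 0.
Proof.
have [i hi] := nweight_eq1 x.
apply/eqP => /rowP/(_ i); rewrite truncate_weightE hi mxE => h.
have : (1 : R) <= 0 by rewrite -h le_max lexx.
by rewrite ler10.
Qed.

Lemma cvg_nweight (T : Type) (F : set_system T) {FF : Filter F} (f : T -> Abar R n) x i :
  f @ F --> x -> (fun y => nweight (f y) 0 i) @ F --> nweight x 0 i.
Proof.
move=> Fx; have h : (fun y => nweight (f y)) @ F --> nweight x.
  by apply: (cvg_apply (h := nweight)) Fx; exact: continuous_nweight.
exact: (cvg_coord (f := nweight \o f)).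
Qed.

Lemma cvg_contract_Abar (T : Type) (F : set_system T) {FF : Filter F}
    (f : T -> Abar R n) (g : T -> R) x (s : R) : f @ F --> x -> g @ F --> s ->
  (fun y => of_weight (truncate_weight (f y) (g y))) @ F --> of_weight (truncate_weight x s).
Proof.
move=> fx gs; apply: (cvg_apply (h := of_weight)).
  by apply: continuous_of_weight; exact: truncate_weight_neq0.
apply: cvg_row => i; rewrite truncate_weightE.
apply: (cvg_ext (fun y => truncate_weightE (f y) (g y) i)).
have hm : {for (nweight x 0 i, s), continuous (fun p : R * R => Num.max p.1 p.2)}.
  exact: max_continuous.
have hp : (fun y => (nweight (f y) 0 i, g y)) @ F --> (nweight x 0 i, s).
  exact: cvg_pair (cvg_nweight fx) gs.
exact: cvg_apply hm hp.
Qed.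

Definition contract_Abar (x : Abar R n) (s : R) := of_weight (truncate_weight x s).

Lemma contract_Abar0 x : contract_Abar x 0 = x.
Proof.
rewrite -[RHS]of_nweight; congr of_weight; apply/rowP => i.
by rewrite mxE max_l// nweight_ge0.
Qed.

(** The inequality holds on [Sij] and is homogeneous, hence a closed condition on the continuous
    normalized weights; it therefore survives on the boundary. *)
Lemma closure_Sij i j (t : R) x : closure (Sij i j t) x ->
  weight x 0 i <= expR t * weight x 0 j.
Proof.
move=> h; have : closure (Sij i j t) `<=` [set y | nweight y 0 i - expR t * nweight y 0 j <= 0].
  have cl : closed [set y : Abar R n | nweight y 0 i - expR t * nweight y 0 j <= 0].
    apply: (@closed_comp _ _ (fun y => nweight y 0 i - expR t * nweight y 0 j) [set s | s <= 0]).
      move=> y _; have c (F : set_system (Abar R n)) (FF : Filter F) : F --> y ->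
          (fun z => nweight z 0 i - expR t * nweight z 0 j) @ F -->
          nweight y 0 i - expR t * nweight y 0 j.
        move=> Fy; apply: cvgB; first exact: cvg_nweight.
        by apply: cvgM; [exact: cvg_cst|exact: cvg_nweight].
      by have := c (nbhs y) _; apply => //; exact: cvg_id.
    exact: closed_le.
  rewrite [X in _ `<=` X](closure_id _).1//; apply: closure_subset => y [yT hy] /=.
  rewrite !mxE yT !finset.in_setT subr_le0 mulrCA; apply: ler_wpM2l.
    by rewrite invr_ge0.
  by rewrite -expRD ler_expR; lra.
by move=> /(_ _ h) /=; rewrite !mxE subr_le0 mulrCA ler_pM2l ?invr_gt0 ?norm_weight_gt0//.
Qed.

End ApartmentTopology.

(** * Equivalent pairs and homothetic seminorms *)

Section IntegralMatrices.
Variables (R : realType) (K : fieldType) (v : K -> \bar R) (n : nat).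
Hypothesis hv : nonarch_local_field v.
Local Notation abs := (absv v).
Implicit Types M : 'M[K]_n.

Lemma absv_det_le1 M : (forall i j, abs (M i j) <= 1) -> abs (\det M) <= 1.
Proof.
move=> h; apply: absv_sum => // s _; rewrite absv_sign// absv_prod//.
by apply: prodr_ile1 => i _; rewrite absv_ge0 h.
Qed.

End IntegralMatrices.

Section Stabilizers.
Variables (R : realType) (K : fieldType) (v : K -> \bar R) (n : nat).
Hypothesis hv : nonarch_local_field v.
Local Notation abs := (absv v).
Implicit Types (M u : 'M[K]_n.+1) (x y : Abar R n) (i j : 'I_n.+1).
Local Notation wt x := (weight x 0).

Definition GLO M := integral_mx v M /\ abs (\det M) = 1.

Lemma integral_mx_weight_le M : integral_mx v M <-> weight_le v (fun=> 1) (fun=> 1) 1 M.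
Proof. by split=> h i j; have := h i j; rewrite mul1r mulr1. Qed.

Lemma GLO1 : GLO 1.
Proof.
split; last by rewrite det1 absv1.
by apply/integral_mx_weight_le/weight_le1 => // i; exact: ler01.
Qed.

Lemma GLO_mul M M' : GLO M -> GLO M' -> GLO (M * M').
Proof.
move=> [iM dM] [iM' dM']; split; last by rewrite det_mulmx absvM// dM dM' mulr1.
move/integral_mx_weight_le in iM; move/integral_mx_weight_le in iM'; apply/integral_mx_weight_le.
by rewrite -[X in weight_le _ _ _ X]mulr1; exact: weight_leM iM iM'.
Qed.

Lemma GLO_unit M : GLO M -> M \is a GRing.unit.
Proof.
by move=> [_ dM]; rewrite -[_ \is a _]/(M \in unitmx) unitmxE unitfE -(absv_gt0 v) dM.
Qed.

Lemma GLO_inv M : GLO M -> GLO M^-1.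
Proof.
move=> gM; have uM : M \in unitmx := GLO_unit gM.
have [iM dM] := gM; split; last by rewrite det_inv absvV// dM invr1.
move=> i j; rewrite -[M^-1]/(invmx M) /invmx uM !mxE absvM// absvV// dM invr1 mul1r.
rewrite /cofactor -signr_odd absv_sign//; apply: absv_det_le1 => // a b; rewrite !mxE; exact: iM.
Qed.

Lemma GLO_row M i : GLO M -> exists j, abs (M i j) = 1.
Proof.
move=> [iM dM]; have [|s hs] := exists_perm hv (M := M); first by rewrite dM.
exists (s i); apply: (prod_squeeze (a := fun i => abs (M i (s i))) (b := fun=> 1)) => // [k|].
  by rewrite absv_ge0 iM.
by rewrite big1.
Qed.

Lemma absv_fine (t : K) : t != 0 -> fine (v t) = - ln (abs t).
Proof. by move=> t0; rewrite /absv (negPf t0) expRK opprK. Qed.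

Lemma fx_weight x i j e :
  (fx (abval x) i j <= v e)%E -> weight x 0 i * abs e <= weight x 0 j.
Proof.
move=> h; have := weight_ge0 x i; rewrite le_eqVlt => /orP[/eqP <-|wi].
  by rewrite mul0r weight_ge0.
have S t : (exists x', abval x' = abval x /\ closure (Sij i j t) x') ->
    weight x 0 i <= expR t * weight x 0 j.
  by move=> [x' [/val_inj -> /closure_Sij]].
have := weight_ge0 x j; rewrite le_eqVlt => /orP[/eqP wj|wj].
  have : (+oo <= fx (abval x) i j)%E.
    apply: le_ereal_inf_tmp => _ [t /S ht <-].
    by move: ht; rewrite -wj mulr0 leNgt wi.
  move=> /le_trans/(_ h); rewrite leye_eq => /eqP/(nlf_v0 hv) ->.
  by rewrite absv0 mulr0 -wj.
have : ((ln (weight x 0 i / weight x 0 j))%:E <= fx (abval x) i j)%E.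
  apply: le_ereal_inf_tmp => _ [t /S ht <-].
  by rewrite lee_fin -ler_expR lnK ?posrE ?divr_gt0// ler_pdivrMr.
move=> /le_trans/(_ h); rewrite -absv_le// expRN lnK ?posrE ?divr_gt0// invf_div.
by rewrite ler_pdivlMr// mulrC.
Qed.

(** With full support, x itself belongs to [Sij] for t = v e. *)
Lemma weight_fx x i j e : (abval x).1 = [set: 'I_n.+1]%SET ->
  weight x 0 i * abs e <= weight x 0 j -> (fx (abval x) i j <= v e)%E.
Proof.
move=> xT; have [->|e0] := eqVneq e 0; first by rewrite (v0 hv) leey.
rewrite !mxE xT !finset.in_setT /absv (negPf e0) -expRD ler_expR (v_fin hv e0) => h.
apply: ereal_inf_lbound; exists (fine (v e)) => //; exists x; split=> //.
by apply: subset_closure; split=> //=; lra.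
Qed.

(** The inverse is the reversed product with negated parameters, again generated by [F]. Applying
    the bound to it as well shows that u is an isometry. *)
Lemma Ugen_weight_le (F : 'I_n.+1 -> 'I_n.+1 -> \bar R) (r : 'I_n.+1 -> R) u :
  (forall i, 0 <= r i) -> (forall i j e, (F i j <= v e)%E -> r i * abs e <= r j) ->
  Ugen v F u -> weight_le v r r 1 u /\ exists u', [/\ Ugen v F u', u * u' = 1 & u' * u = 1].
Proof.
move=> r0 rF [s [hs ->]]; elim: s hs => [_|[[i j] e] s IH /= /andP[/andP[ij Fe] /IH]].
  rewrite big_nil; split; first exact: weight_le1.
  by exists 1; split; rewrite ?mulr1//; exact: Ugen1.
rewrite big_cons /=; set u1 := \prod_(_ <- _) _ => -[h [u' [hu' e1 e2]]]; split.
  rewrite -[1]mulr1; apply: weight_leM h => //.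
  by apply: weight_le_elem => //; exact: rF.
exists (u' * elem i j (- e)); split.
- apply: UgenM => //; exists [:: (i, j, - e)]; rewrite /= ij big_seq1; split=> //.
  rewrite andbT; suff -> : v (- e) = v e by [].
  have [->|e0] := eqVneq e 0; first by rewrite oppr0.
  rewrite (v_fin hv e0) v_fin ?oppr_eq0// !absv_fine ?oppr_eq0// absvN//.
- by rewrite mulrA -[elem i j e * u1 * u']mulrA e1 mulr1 elemD// subrr elem0.
- by rewrite mulrA -[u' * _ * _]mulrA elemD// addNr elem0 mulr1.
Qed.

Lemma monoE (s : {perm 'I_n.+1}) (d : 'I_n.+1 -> K) a b :
  mono s d a b = if a == s b then d a else 0.
Proof. by rewrite mxE. Qed.

Lemma mono_mulr (s : {perm 'I_n.+1}) (d : 'I_n.+1 -> K) M a b :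
  (M * mono s d) a b = M a (s b) * d (s b).
Proof.
rewrite !mxE (bigD1 (s b))//= big1 ?addr0 => [|k kb]; rewrite mxE ?eqxx//.
by rewrite (negPf kb) mulr0.
Qed.

Lemma mono_mulV (s : {perm 'I_n.+1}) (d : 'I_n.+1 -> K) : (forall k, d k != 0) ->
  mono s d * mono s^-1 (fun i => (d (s i))^-1) = 1.
Proof.
move=> d0; apply/matrixP => a b; rewrite mono_mulr !mxE permKV.
by case: eqP => [->|_]; rewrite ?mulfV// mul0r.
Qed.

Lemma mono_inv (s : {perm 'I_n.+1}) (d : 'I_n.+1 -> K) : (forall k, d k != 0) ->
  [/\ mono s d \is a GRing.unit, mono s d * (mono s d)^-1 = 1 &
     (mono s d)^-1 = mono s^-1 (fun i => (d (s i))^-1)].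
Proof.
move=> d0; have e := mono_mulV s d0.
have u : mono s d \is a GRing.unit by have [] := mulmx1_unit e.
by split; rewrite ?divrr//; apply: (mulrI u); rewrite divrr.
Qed.

Lemma nu_weight_le s d x y : (forall k, d k != 0) -> nu v s d (abval x) = abval y ->
  exists2 c, 0 < c & weight_le v (wt y) (wt x) c (mono s d) /\
                     weight_le v (wt x) (wt y) c^-1 (mono s d)^-1.
Proof.
move=> d0 /esym /weight_sI [c c0 hc].
have key i : weight y 0 (s i) * abs (d (s i)) = c * weight x 0 i.
  rewrite hc !mxE mem_imset; last exact: perm_inj.
  rewrite permK -mulrA; congr (_ * _); case: ifP => _; last by rewrite mul0r.
  by rewrite opprB absv_fine// -{2}[abs _]lnK ?posrE ?absv_gt0// -expRD; congr expR; lra.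
exists c => //; split=> i j.
  rewrite monoE; case: (i =P s j) => [->|_]; first by rewrite key.
  by rewrite absv0 mulr0 mulr_ge0 ?weight_ge0// ltW.
have [_ _ ->] := mono_inv s d0; rewrite monoE.
case: (i =P (s^-1)%g j) => [->|_]; last by rewrite absv0 mulr0 mulr_ge0 ?weight_ge0// invr_ge0 ltW.
have := key ((s^-1)%g j); rewrite permKV absvV// ler_pdivrMr ?absv_gt0// -mulrA => ->.
by rewrite mulKf// gt_eqF.
Qed.

(** Here m is g^-1 h and m' its inverse; the two bounds together say that the seminorm of a is c
    times that of b. Naming both matrices makes symmetry and transitivity immediate. *)
Definition homothetic (a b : Ucar v n * Abar R n) : Prop :=
  exists m m' c, [/\ 0 < c, ucval b.1 = ucval a.1 * m, ucval a.1 = ucval b.1 * m',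
    weight_le v (wt a.2) (wt b.2) c m & weight_le v (wt b.2) (wt a.2) c^-1 m'].

Definition Aorigin : Abar R n := MkAbar (origin_pred R n).

Lemma weight_Aorigin i : weight Aorigin 0 i = 1.
Proof. by rewrite !mxE finset.in_setT oppr0 expR0. Qed.

Lemma imset_perm1 (I : {set 'I_n.+1}) : ((1%g : {perm 'I_n.+1}) @: I)%SET = I.
Proof. by rewrite (eq_imset _ (@perm1 _)) imset_id. Qed.

(** Fixing the origin already forces all valuations v (d k) to coincide. *)
Lemma Ztilde_absv d : (forall k, d k != 0) ->
  (forall x : Abar R n, (abval x).1 = [set: 'I_n.+1]%SET -> nu v 1%g d (abval x) = abval x) ->
  forall k, abs (d k) = abs (d ord0).
Proof.
move=> d0 h k; have := congr1 snd (h Aorigin erefl) => /=.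
rewrite -[RHS](@sI_id _ _ [set: 'I_n.+1]%SET 0); last 2 first.
- by move=> i; rewrite finset.in_setT.
- by rewrite big1// => i _; rewrite mxE.
rewrite imset_perm1 => /sI_eqP [c hc].
have f i : fine (v (d i)) = c.
  by have := hc i (finset.in_setT i); rewrite !mxE => /eqP;
    rewrite sub0r eq_sym addrC subr_eq0 => /eqP.
by rewrite /absv !(negPf (d0 _)) !f.
Qed.

Lemma U0hat_ucval (g : Ucar v n) : U0hat v (ucval g).
Proof. by case: g => ? /= /asboolP. Qed.

(** The factor u and its inverse both preserve the sup norm, which is the norm of the origin, so u
    lies in GL_n(O); the factor t is the scalar d_0 times a diagonal matrix of units. *)
Lemma U0hat_GLO (g : 'M[K]_n.+1) : U0hat v g -> exists2 l, l != 0 & GLO (l *: g).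
Proof.
move=> [u [t [hu [[d [d0 [-> hd]]] ->]]]].
have hdk := Ztilde_absv d0 hd.
exists (d ord0)^-1; first by rewrite invr_eq0.
rewrite scalerAr; apply: GLO_mul.
  have [||h [u' [hu' e _]]] := @Ugen_weight_le (fx (origin R n)) (wt Aorigin) u _ _ hu.
  - by move=> i; exact: weight_ge0.
  - exact: (@fx_weight Aorigin).
  have iO w : weight_le v (wt Aorigin) (wt Aorigin) 1 w -> integral_mx v w.
    by move=> hw i j; have := hw i j; rewrite !weight_Aorigin mulr1 mul1r.
  split; first exact: iO.
  have [||h' _] := @Ugen_weight_le (fx (origin R n)) (wt Aorigin) u' _ _ hu'.
  - by move=> i; exact: weight_ge0.
  - exact: (@fx_weight Aorigin).
  have e1 : abs (\det u) * abs (\det u') = 1.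
    by rewrite -absvM// -det_mulmx -[u *m u']/(u * u') e det1 absv1.
  apply/le_anti; rewrite (absv_det_le1 hv (iO _ h)) /= -{1}e1.
  by rewrite ler_piMr ?absv_ge0// (absv_det_le1 hv (iO _ h')).
have -> : (d ord0)^-1 *: mono 1 d = mono 1 (fun k => (d ord0)^-1 * d k).
  by apply/matrixP => a b; rewrite !mxE; case: eqP; rewrite ?mulr0.
have ab k : abs ((d ord0)^-1 * d k) = 1.
  by rewrite absvM// absvV// hdk mulVf// gt_eqF// absv_gt0.
split=> [i j|].
  by rewrite mxE; case: eqP; rewrite ?ab// absv0.
rewrite mono1E det_diag absv_prod// big1// => i _.
by rewrite mxE ab.
Qed.

Lemma U0hat_unit (g : 'M[K]_n.+1) : U0hat v g -> g \is a GRing.unit.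
Proof.
move=> /U0hat_GLO [l l0 /GLO_unit lg1]; have : l *: g \in unitmx := lg1.
by rewrite unitmxZ// unitfE.
Qed.

Lemma nu_const d x (c : R) : (forall k, fine (v (d k)) = c) ->
  nu v 1%g d (abval x) = abval x.
Proof.
move=> h; rewrite /nu imset_perm1 [RHS]abval_sI; congr pair.
by apply: (@eq_sI _ _ _ _ _ (- c)) => i _; rewrite !mxE invg1 perm1 h.
Qed.

Lemma nu_diag d x : (forall k, abs (d k) = 1) -> nu v 1%g d (abval x) = abval x.
Proof.
move=> h; apply: (@nu_const _ _ 0) => k.
by rewrite absv_fine ?h ?ln1 ?oppr0// -(absv_gt0 v) h.
Qed.

Lemma GLO_U0hat (g : 'M[K]_n.+1) : GLO g -> U0hat v g.
Proof.
move=> [ig dg].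
have [|i j e||u [t [hu ht ->]]] := @elimination _ _ _ n hv (fun=> 1) (fx (origin R n)) _ _ g _ dg.
- by [].
- rewrite mul1r => e1; apply: (@weight_fx Aorigin) => //.
  by rewrite !weight_Aorigin mul1r.
- exact/integral_mx_weight_le.
exists u, (mono 1 t); split=> //; split=> //; exists t; split.
  by move=> k; rewrite -(absv_gt0 v) ht.
by split=> // x _; exact: nu_diag.
Qed.

(** The definition of [sim] writes g^-1 h as a monomial matrix fixing x, times an isometry u, times
    the inverse of a monomial matrix carrying x to y. Each monomial matrix is a homothety between
    the weights. *)
Lemma sim_homothetic a b : sim a b -> homothetic a b.
Proof.
case: a b => [g x] [h y] [s [d [d0 [/= xy [m0 [u [[s0 [d1 [d10 [-> xx]]]] [hu e]]]]]]]].
have [c c0 [n1 n2]] := nu_weight_le d0 xy.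
have [c1 c10 [n3 n4]] := nu_weight_le d10 xx.
have [||u1 [u' [hu' e1 e2]]] := @Ugen_weight_le (fx (abval x)) (wt x) u _ _ hu.
- by move=> i; exact: weight_ge0.
- by move=> i j f; exact: fx_weight.
have [||u2 _] := @Ugen_weight_le (fx (abval x)) (wt x) u' _ _ hu'.
- by move=> i; exact: weight_ge0.
- by move=> i j f; exact: fx_weight.
have [un _ _] := mono_inv s d0; have [un0 _ _] := mono_inv s0 d10.
have ug : ucval g \is a GRing.unit by apply: U0hat_unit; exact: U0hat_ucval.
have uh : ucval h \is a GRing.unit by apply: U0hat_unit; exact: U0hat_ucval.
have e' : ucval h * mono s d = ucval g * (mono s0 d1 * u).
  by rewrite -e !mulrA divrr// mul1r.
have wx i : 0 <= weight x 0 i by exact: weight_ge0.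
have wy i : 0 <= weight y 0 i by exact: weight_ge0.
have ci : 0 <= c^-1 by rewrite invr_ge0 ltW.
have c1i : 0 <= c1^-1 by rewrite invr_ge0 ltW.
exists (mono s0 d1 * u * (mono s d)^-1), (mono s d * u' * (mono s0 d1)^-1), (c1 * 1 * c^-1).
split.
- by rewrite mulr1 divr_gt0.
- by rewrite /= mulrA -e' mulrK.
- rewrite /= !mulrA e'.
  have -> : ucval g * (mono s0 d1 * u) * u' / mono s0 d1 =
      ucval g * (mono s0 d1 * (u * u') / mono s0 d1) by rewrite !mulrA.
  by rewrite e1 mulr1 divrr// mulr1.
- apply: (weight_leM hv _ ci wx wy _ n2); first by rewrite mulr1 ltW.
  by apply: (weight_leM hv _ _ wx wx n3 u1) => //; exact: ltW.
- rewrite mulr1 invf_div -[c / c1]/(c * c1^-1) -[c in c * _]mulr1.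
  apply: (weight_leM hv _ c1i wy wx _ n4); first by rewrite mulr1 ltW.
  by apply: (weight_leM hv _ _ wy wx n1 u2) => //; exact: ltW.
Qed.

Lemma eqclos_homothetic a b : eqclos (@sim R K v n) a b -> homothetic a b.
Proof.
move=> h; apply: h.
- move=> [g x]; exists 1, 1, 1; rewrite invr1; split; rewrite ?mulr1 ?ltr01//;
    by apply: weight_le1 => // i; exact: weight_ge0.
- by move=> ? ? [m [m' [c [c0 e1 e2 h1 h2]]]]; exists m', m, c^-1; rewrite invr_gt0 invrK.
- move=> ? ? ? [m [m' [c [c0 e1 e2 h1 h2]]]] [p [p' [f [f0 g1 g2 k1 k2]]]].
  exists (m * p), (p' * m'), (c * f); split.
  + exact: mulr_gt0.
  + by rewrite g1 e1 mulrA.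
  + by rewrite e2 g2 mulrA.
  + by apply: (weight_leM hv _ _ _ _ h1 k1) => [||i|i]; rewrite ?weight_ge0// ltW.
  + rewrite invfM mulrC; apply: (weight_leM hv _ _ _ _ k2 h2) => [||i|i];
      by rewrite ?weight_ge0// invr_ge0 ltW.
- by move=> ? ?; exact: sim_homothetic.
Qed.

(* The monomial matrix realizing [sim] is read off from [matching_perm]; the
   weighted elimination then puts the remaining factor into [U_x]. *)
Lemma interior_sim (a b : Ucar v n * Abar R n) (m m' : 'M[K]_n.+1) (l : K)
    (r r' : 'I_n.+1 -> R) (p q : R) : l != 0 ->
  ucval b.1 = l *: (ucval a.1 * m) -> GLO m -> GLO m' ->
  (forall i, 0 < r i) -> (forall i, 0 < r' i) -> 0 < p -> 0 < q ->
  (forall i, weight a.2 0 i = p * r i) -> (forall i, weight b.2 0 i = q * r' i) ->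
  weight_le v r r' 1 m -> weight_le v r' r 1 m' -> sim a b.
Proof.
case: a b => [g x] [h y] /= l0 hg [im dm] [im' dm'] r0 r'0 p0 q0 wx wy h1 h2.
have full (z : Abar R n) (f : R) (t : 'I_n.+1 -> R) : 0 < f ->
    (forall i, weight z 0 i = f * t i) ->
    (forall i : 'I_n.+1, 0 < t i) -> (abval z).1 = [set: 'I_n.+1]%SET.
  move=> f0 wz t0; apply/setP => i; rewrite finset.in_setT.
  by apply/negPn; rewrite -weight_eq0 wz mulf_neq0// gt_eqF.
have xT := full x p r p0 wx r0; have yT := full y q r' q0 wy r'0.
have [s hs] := matching_perm hv r0 r'0 im dm dm' h1 h2.
have d1 : abs (\det (m * mono s (fun=> 1))) = 1.
  rewrite det_mulmx absvM// dm mul1r.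
  have -> : mono s (fun=> 1) = (perm_mx s)^T :> 'M[K]_n.+1.
    by apply/matrixP => i j; rewrite !mxE eq_sym; case: eqP.
  by rewrite det_tr det_perm -[_ ^+ _]mulr1 absv_sign// absv1.
have [||u [t [hu ht e]]] :=
  @elimination _ _ _ n hv r (fx (abval x)) r0 _ (m * mono s (fun=> 1)) _ d1.
- move=> i j f hf; apply: weight_fx => //; rewrite !wx -mulrA.
  by rewrite ler_pM2l.
- by move=> i j; rewrite mono_mulr mulr1 (hs j).
have t0 k : t k != 0 by rewrite -(absv_gt0 v) ht.
(* Elimination gives m * mono s 1 = u * diag(t). Dividing column j by l * t j leaves u alone, so the
   [Nx] factor can be the identity. *)
pose d k := (l * t ((s^-1)%g k))^-1.
have d0 k : d k != 0 by rewrite invr_eq0 mulf_neq0.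
exists s, d; split => //; split.
  have sT : (s @: [set: 'I_n.+1])%SET = [set: 'I_n.+1]%SET.
    apply/setP => i; rewrite finset.in_setT; apply/imsetP.
    by exists ((s^-1)%g i); rewrite ?permKV.
  rewrite /nu xT sT [RHS]abval_sI yT; congr pair.
  apply: (@eq_sI _ _ _ _ _ (ln q - ln p - ln (abs l))) => k _; rewrite !mxE.
  rewrite absv_fine// /d absvV// absvM// ht mulr1 lnV ?posrE ?absv_gt0// !opprK.
  have lnx i : (abval x).2 0 i = - (ln p + ln (r i)).
    by rewrite -lnM ?posrE// -wx mxE xT finset.in_setT expRK opprK.
  have lny i : (abval y).2 0 i = - (ln q + ln (r' i)).
    by rewrite -lnM ?posrE// -wy mxE yT finset.in_setT expRK opprK.
  by rewrite lnx lny hs permKV; lra.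
have ug : ucval g \is a GRing.unit by apply: U0hat_unit; exact: U0hat_ucval.
exists 1, u; split; last split => //.
  exists 1%g, (fun=> 1); split=> [k|]; first exact: oner_neq0.
  split; last by apply: nu_diag => k; rewrite absv1.
  by apply/matrixP => i j; rewrite !mxE perm1; case: eqP.
rewrite mul1r hg -scalerAr mulKr//.
apply/matrixP => i j; rewrite mono_mulr /d permK mxE.
have := congr1 (fun z : 'M[K]_n.+1 => z i j) e.
rewrite !mono_mulr perm1 mulr1 => ->.
by rewrite invfM mulrACA mulfV// mul1r mulfK.
Qed.

Lemma homothetic_integral a b : homothetic a b -> exists m m' l,
  [/\ l != 0, ucval b.1 = l *: (ucval a.1 * m), GLO m, GLO m' &
   weight_le v (nweight a.2 0) (nweight b.2 0) 1 m /\
   weight_le v (nweight b.2 0) (nweight a.2 0) 1 m'].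
Proof.
case: a b => [g x] [h y] [m [m' [c [c0 /= hg gh h1 h2]]]].
have [l l0 gl] := U0hat_GLO (U0hat_ucval g); have [k k0 hk] := U0hat_GLO (U0hat_ucval h).
have ug := GLO_unit gl; have uh := GLO_unit hk.
have gm : GLO ((k / l) *: m).
  have -> : (k / l) *: m = (l *: ucval g)^-1 * (k *: ucval h).
    by apply: (mulrI ug); rewrite mulVKr// hg -scalerAl -scalerAr scalerA mulrCA mulfV// mulr1.
  by apply: GLO_mul => //; exact: GLO_inv.
have gm' : GLO ((l / k) *: m').
  have -> : (l / k) *: m' = (k *: ucval h)^-1 * (l *: ucval g).
    by apply: (mulrI uh); rewrite mulVKr// gh -scalerAl -scalerAr scalerA mulrCA mulfV// mulr1.
  by apply: GLO_mul => //; exact: GLO_inv.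
have [a a0 wa] : exists2 a, 0 < a & forall i, weight x 0 i = a * nweight x 0 i.
  exists `|weight x|; first exact: norm_weight_gt0.
  exact: weight_nweight.
have [b b0 wb] : exists2 b, 0 < b & forall i, weight y 0 i = b * nweight y 0 i.
  exists `|weight y|; first exact: norm_weight_gt0.
  exact: weight_nweight.
(* The homothety factor after rescaling the matrices into GL_n(O) and the weights to maximum 1. *)
pose f := c * b * abs (k / l) / a.
have kl0 : 0 < abs (k / l) by rewrite absv_gt0 mulf_neq0// invr_eq0.
have f0 : 0 < f by rewrite divr_gt0// !mulr_gt0.
have H1 i j : nweight x 0 i * abs (((k / l) *: m) i j) <= f * nweight y 0 j.
  rewrite [((k / l) *: m) _ _]mxE absvM//.
  have := ler_wpM2r (ltW kl0) (h1 i j); rewrite wa wb => H.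
  rewrite -(ler_pM2l a0).
  have -> : a * (f * nweight y 0 j) = c * (b * nweight y 0 j) * abs (k / l).
    by rewrite /f; field; rewrite gt_eqF.
  suff -> : a * (nweight x 0 i * (abs (k / l) * abs (m i j))) =
    a * nweight x 0 i * abs (m i j) * abs (k / l) by [].
  by ring.
have H2 i j : nweight y 0 i * abs (((l / k) *: m') i j) <= f^-1 * nweight x 0 j.
  have -> : abs (((l / k) *: m') i j) = (abs (k / l))^-1 * abs (m' i j).
    by rewrite mxE absvM// -absvV// invf_div.
  have := h2 i j; rewrite wa wb => H.
  rewrite -(ler_pM2l b0) -(ler_pM2l kl0).
  have -> : abs (k / l) * (b * (f^-1 * nweight x 0 j)) = c^-1 * (a * nweight x 0 j).
    by rewrite /f; field; rewrite !gt_eqF.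
  suff -> : abs (k / l) * (b * (nweight y 0 i * ((abs (k / l))^-1 * abs (m' i j)))) =
    b * nweight y 0 i * abs (m' i j) by [].
  by field; rewrite gt_eqF.
(* A coordinate of weight 1 and a unit entry in its row turn [H2] into f <= 1 and [H1] into f >=
   1. *)
have f1 : f = 1.
  apply/le_anti/andP; split.
    have [i hi] := nweight_eq1 y; have [j hj] := GLO_row i gm'.
    have := H2 i j; rewrite hi hj mulr1 => H.
    have : 1 <= f^-1 * 1 by apply: (le_trans H); rewrite ler_pM2l ?invr_gt0// nweight_le1.
    by rewrite mulr1 invf_ge1.
  have [i hi] := nweight_eq1 x; have [j hj] := GLO_row i gm.
  have := H1 i j; rewrite hi hj mulr1 => H.
  have : 1 <= f * 1 by apply: (le_trans H); rewrite ler_pM2l// nweight_le1.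
  by rewrite mulr1.
exists ((k / l) *: m), ((l / k) *: m'), (l / k); split=> //.
- by rewrite mulf_neq0// invr_eq0.
- rewrite /= hg -scalerAr scalerA.
  by rewrite mulrA divfK// divff// scale1r.
split=> i j; first by have := H1 i j; rewrite f1.
by have := H2 i j; rewrite f1 invr1.
Qed.

Lemma weight_contract x s : 0 <= s -> exists2 c, 0 < c &
  forall i, weight (contract_Abar x s) 0 i = c * Num.max (nweight x 0 i) s.
Proof.
move=> s0; have [c c0 h] := weight_of_weight (truncate_weight_neq0 x s).
exists c => // i; rewrite h truncate_weightE ger0_norm//.
by rewrite le_max s0 orbT.
Qed.

Lemma weight_le_max (r r' : 'I_n.+1 -> R) m s : 0 <= s -> integral_mx v m ->
  weight_le v r r' 1 m ->
  weight_le v (fun i => Num.max (r i) s) (fun i => Num.max (r' i) s) 1 m.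
Proof.
move=> s0 im h i j; rewrite mul1r.
case: (leP (r i) s) => _.
  rewrite le_max; apply/orP; right; rewrite -[leRHS]mulr1.
  by apply: ler_wpM2l.
by rewrite le_max; apply/orP; left; have := h i j; rewrite mul1r.
Qed.

Lemma contract_sim a b s : 0 < s -> homothetic a b ->
  sim (a.1, contract_Abar a.2 s) (b.1, contract_Abar b.2 s).
Proof.
move=> s0 /homothetic_integral [m [m' [l [l0 e gm gm' [h1 h2]]]]].
have [p p0 hp] := weight_contract a.2 (ltW s0).
have [q q0 hq] := weight_contract b.2 (ltW s0).
apply: (@interior_sim (a.1, _) (b.1, _) m m' l
  (fun i => Num.max (nweight a.2 0 i) s) (fun i => Num.max (nweight b.2 0 i) s)
  p q l0 e gm gm' _ _ p0 q0 hp hq).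
- by move=> i; rewrite lt_max s0 orbT.
- by move=> i; rewrite lt_max s0 orbT.
- by apply: weight_le_max (ltW s0) _ h1; case: gm.
- by apply: weight_le_max (ltW s0) _ h2; case: gm'.
Qed.

(** At level 1 all weights are equal, so both points are the origin, and g^-1 h is an element of
    GL_n(O) up to a scalar. *)
Lemma contract1_sim (a b : Ucar v n * Abar R n) :
  sim (a.1, contract_Abar a.2 1) (b.1, contract_Abar b.2 1).
Proof.
case: a b => [g x] [h y] /=.
have [l l0 gl] := U0hat_GLO (U0hat_ucval g); have [k k0 hk] := U0hat_GLO (U0hat_ucval h).
have ug := GLO_unit gl.
have gm := GLO_mul (GLO_inv gl) hk.
have w1 (z : Abar R n) : exists2 c, 0 < c & forall i, weight (contract_Abar z 1) 0 i = c * 1.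
  have [c c0 hc] := weight_contract z ler01; exists c => // i.
  by rewrite hc max_r// nweight_le1.
have [p p0 hp] := w1 x; have [q q0 hq] := w1 y.
apply: (@interior_sim (g, _) (h, _) _ _ (l / k) (fun=> 1) (fun=> 1) p q _ _ gm (GLO_inv gm)) => //=.
- by rewrite mulf_neq0// invr_eq0.
- apply: (scalerI k0); rewrite scalerA mulrCA mulfV// mulr1 scalerAl.
  by rewrite mulVKr.
- by apply/integral_mx_weight_le; case: gm.
- by apply/integral_mx_weight_le; case: (GLO_inv gm).
Qed.

End Stabilizers.

(** * Topology of the compactification *)

Lemma ultra_has (T : Type) (I : eqType) (F : set_system T) (s : seq I) (P : I -> set T) :
  UltraFilter F -> F [set t | exists2 i, i \in s & P i t] -> exists2 i, i \in s & F (P i).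
Proof.
move=> FU; elim: s => [/filter_ex [t [i]]//|i s IH h].
have [Fi|Fi] := in_ultra_setVsetC (P i) FU; first by exists i; rewrite ?mem_head.
have /IH [j js Fj] : F [set t | exists2 i, i \in s & P i t].
  apply: filterS (filterI h Fi) => t [[j]]; rewrite inE => /orP[/eqP ->|js] Pj nP //.
  by exists j.
by exists j; rewrite // inE js orbT.
Qed.

(** * Total boundedness and completeness of the ring of integers *)

Section IntegerRing.
Variables (R : realType) (K : fieldType) (v : K -> \bar R).
Hypothesis hv : nonarch_local_field v.
Local Notation abs := (absv v).

(** The centres are the truncated expansions in powers of the uniformizer, with digits among
    finitely many residue representatives. *)
Lemma integers_cover (k : nat) : exists s : seq K,
  forall x, abs x <= 1 -> exists2 a, a \in s & abs (x - a) <= expR (- k%:R).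
Proof.
elim: k => [|k [s hs]].
  by exists [:: 0] => x hx; exists 0; rewrite ?mem_head// subr0 oppr0 expR0.
have [pi hpi] := nlf_normalized hv; have [t [_ ht]] := nlf_residue_finite hv.
have pi0 : pi != 0 by apply/eqP => e; move: hpi; rewrite e (v0 hv).
have apik : abs (pi ^+ k) = expR (- k%:R).
  elim: (k) => [|m IH]; first by rewrite expr0 absv1// oppr0 expR0.
  rewrite exprS absvM// IH /absv (negPf pi0) hpi /= -expRD; congr expR.
  by rewrite -[m.+1]add1n natrD; lra.
exists [seq a + pi ^+ k * r | a <- s, r <- t] => x /hs [a sa hxa].
pose y := (x - a) / pi ^+ k.
have y1 : abs y <= 1.
  by rewrite absvM// absvV// apik ler_pdivrMr ?expR_gt0// mul1r.
have [r tr hr] : exists2 r, r \in t & (1 <= v (y - r)%R)%E.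
  by apply: ht; rewrite -absv_le// oppr0 expR0.
exists (a + pi ^+ k * r); first by apply/allpairsP; exists (a, r).
have -> : x - (a + pi ^+ k * r) = pi ^+ k * (y - r).
  by rewrite mulrBr /y mulrCA mulfV ?expf_neq0// mulr1 opprD addrA.
rewrite absvM// apik -[k.+1]addn1 natrD opprD expRD ler_pM2l ?expR_gt0//.
by rewrite absv_le.
Qed.

Lemma expRN_nat (y : R) : exists k : nat, expR (- k%:R) < expR (- y).
Proof.
exists (Num.truncn (Num.max y 0)).+1; rewrite ltr_expR ltrN2.
apply: le_lt_trans (truncnS_gt _); by rewrite le_max lexx.
Qed.

(** For each k the ultrafilter selects one ball of a finite cover. Any two selected balls meet, so
    their centres form a Cauchy sequence. *)
Lemma ultra_integer_limit (T : Type) (F : set_system T) (f : T -> K) :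
  UltraFilter F -> F [set t | abs (f t) <= 1] ->
  exists l, forall k : nat, F [set t | abs (f t - l) <= expR (- k%:R)].
Proof.
move=> FU h.
have /choice [a ha] : forall k : nat, exists a, F [set t | abs (f t - a) <= expR (- k%:R)].
  move=> k; have [s hs] := integers_cover k.
  have [|a _ Fa] := @ultra_has _ _ F s (fun a => [set t | abs (f t - a) <= expR (- k%:R)]) FU.
    by apply: filterS h => t /hs.
  by exists a.
have mono (k p : nat) : (k <= p)%N -> expR (- p%:R) <= expR (- k%:R) :> R.
  by move=> kp; rewrite ler_expR lerN2 ler_nat.
have cauchy (k p q : nat) : (k <= p)%N -> (k <= q)%N -> abs (a p - a q) <= expR (- k%:R).
  move=> kp kq; have [t [/= h1 h2]] := filter_ex (filterI (ha p) (ha q)).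
  have -> : a p - a q = (f t - a q) - (f t - a p) by ring.
  by apply: absvB => //; [exact: le_trans h2 (mono _ _ kq)|exact: le_trans h1 (mono _ _ kp)].
have [|l hl] := nlf_complete hv (u := a).
  move=> y; have [k hk] := expRN_nat y; exists k => p q kp kq.
  by rewrite -absv_le// (le_trans (cauchy _ _ _ kp kq))// ltW.
exists l => k; have [N hN] := hl k%:R.
have := ha (maxn N k); apply: filterS => t /= ht.
have -> : f t - l = (f t - a (maxn N k)) + (a (maxn N k) - l) by ring.
apply: absvD => //; first by apply: le_trans ht (mono _ _ _); exact: leq_maxr.
by rewrite absv_le// hN// leq_maxl.
Qed.

(** Products of integral factors differ by at most c, by telescoping. This keeps determinants of
    limits of elements of GL_n(O) units. *)
Lemma absv_det_sub (m : nat) (A B : 'M[K]_m) (c : R) : 0 <= c ->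
  (forall i j, abs (A i j) <= 1) -> (forall i j, abs (B i j) <= 1) ->
  (forall i j, abs (A i j - B i j) <= c) -> abs (\det A - \det B) <= c.
Proof.
move=> c0 hA hB h; rewrite /determinant -sumrB; apply: absv_sum => // s _.
rewrite -mulrBr absv_sign//.
suff [] : [/\ abs (\prod_i A i (s i)) <= 1, abs (\prod_i B i (s i)) <= 1 &
    abs (\prod_i A i (s i) - \prod_i B i (s i)) <= c] by [].
elim/big_ind2: _ => //.
  by rewrite absv1// lexx subrr absv0.
move=> y1 x1 y2 x2 [a1 b1 c1] [a2 b2 c2]; rewrite !absvM//; split.
- by rewrite -[leRHS]mulr1 ler_pM ?absv_ge0.
- by rewrite -[leRHS]mulr1 ler_pM ?absv_ge0.
have -> : x1 * x2 - y1 * y2 = x1 * (x2 - y2) + (x1 - y1) * y2 by ring.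
apply: absvD => //; rewrite absvM//.
  by rewrite -[leRHS]mul1r ler_pM ?absv_ge0.
by rewrite -[leRHS]mulr1 ler_pM ?absv_ge0.
Qed.

End IntegerRing.

Section Compactification.
Local Open Scope quotient_scope.
Variables (R : realType) (K : fieldType) (v : K -> \bar R) (n : nat).
Hypothesis hv : nonarch_local_field v.
Local Notation abs := (absv v).
Local Notation U := (Ucar v n).
Local Notation Ab := (Abar R n).
Local Notation Xb := (Xbar v n).

Definition mkU (g : 'M[K]_n.+1) (h : U0hat v g) : U := MkUcar (asboolT h).

Lemma compact_GLO : compact [set g : U | GLO v (ucval g)].
Proof.
rewrite compact_ultra => F FU FG.
have /choice [l hl] : forall ij : 'I_n.+1 * 'I_n.+1, exists l, forall k : nat,
    F [set g : U | abs (ucval g ij.1 ij.2 - l) <= expR (- k%:R)].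
  move=> [i j]; apply: (ultra_integer_limit hv) => //.
  by apply: filterS FG => g [ig _]; exact: ig.
pose M := \matrix_(i, j) l (i, j) : 'M[K]_n.+1.
have near1 : F [set g : U | forall ij : 'I_n.+1 * 'I_n.+1,
    abs (ucval g ij.1 ij.2 - l ij) <= expR (- 1%:R)].
  have : \forall g \near F, forall ij : 'I_n.+1 * 'I_n.+1,
      abs (ucval (g : U) ij.1 ij.2 - l ij) <= expR (- 1%:R).
    by apply: filter_forall => ij; exact: (hl ij 1%N).
  by [].
have e1 : expR (- 1%:R) < 1 :> R by rewrite expR_lt1 oppr_lt0 ltr0n.
have GM : GLO v M.
  have [g [[ig dg] hg]] := filter_ex (filterI FG near1).
  have gM i j : abs (ucval g i j - M i j) <= expR (- 1%:R).
    by have := hg (i, j); rewrite /M mxE.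
  have iM : integral_mx v M.
    move=> i j; have -> : M i j = ucval g i j - (ucval g i j - M i j) by ring.
    by apply: absvB => //; apply: le_trans (gM i j) (ltW e1).
  split=> //; apply/le_anti; rewrite (absv_det_le1 hv iM) /= leNgt; apply/negP => lt.
  have := absv_det_sub hv (expR_ge0 _) ig iM gM => /le_lt_trans/(_ e1) lt'.
  have := absvD_lt hv lt' lt; rewrite subrK dg ltxx.
  by [].
have UM := GLO_U0hat hv GM.
exists (mkU UM); split=> //.
apply: (@cvg_subbase _ (@Ucar_base R K v n)) => // B [i [j [a [k ->]]]].
rewrite /= -absv_lt// mxE => hM; have [N hN] := expRN_nat k.
apply: filterS (hl (i, j) N) => g /= hg; rewrite -absv_lt//.
have -> : ucval g i j - a = (ucval g i j - l (i, j)) + (l (i, j) - a) by ring.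
by apply: absvD_lt => //; exact: le_lt_trans hg hN.
Qed.

Lemma piP (a b : U * Ab) : \pi_(Xb) a = \pi_(Xb) b <-> eqclos (@sim R K v n) a b.
Proof. by split=> [/eqmodP/asboolP|h]//; apply/eqmodP/asboolP. Qed.

Lemma eqclos_sim (a b : U * Ab) : sim a b -> eqclos (@sim R K v n) a b.
Proof. by move=> h E _ _ _; apply. Qed.

Lemma continuous_piX : continuous (\pi_(Xb) : U * Ab -> Xb).
Proof. exact: pi_continuous. Qed.

Lemma open_piX (O : set Xb) : open (\pi_(Xb) @^-1` O) -> open O.
Proof. by []. Qed.

(** [Ucar] holds matrices and not classes modulo scalars; this lemma restores the passage to PGL. *)
Lemma sim_scale (g h : U) (x : Ab) (l : K) : l != 0 ->
  ucval h = l *: ucval g -> sim (g, x) (h, x).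
Proof.
move=> l0 e; exists 1%g, (fun=> l^-1); split; first by move=> _; rewrite invr_eq0.
split; first exact: (@nu_const _ _ v _ _ _ (fine (v l^-1))).
exists 1, 1; rewrite /= mulr1; split; last split.
- exists 1%g, (fun=> 1); split=> [_|]; first exact: oner_neq0.
  split; last by apply: nu_diag => k; rewrite absv1.
  by apply/matrixP => i j; rewrite !mxE perm1; case: eqP.
- exact: Ugen1.
rewrite e -scalerAr mulVr ?(U0hat_unit hv (U0hat_ucval g))// -scalerAl mul1r.
apply/matrixP => i j; rewrite !mxE perm1; case: eqP => _; last by rewrite mulr0.
by rewrite mulfV.
Qed.

Lemma compact_Xbar : compact [set: Xb].
Proof.
have -> : [set: Xb] = \pi_(Xb) @` ([set g : U | GLO v (ucval g)] `*` [set: Ab]).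
  rewrite eqEsubset; split=> // z _; rewrite -[z]reprK; case: (repr z) => g x.
  have [l l0 gl] := U0hat_GLO hv (U0hat_ucval g).
  exists (mkU (GLO_U0hat hv gl), x); first by split.
  by apply: esym; apply/piP; apply: eqclos_sim; exact: (sim_scale x l0).
apply: continuous_compact; first exact/continuous_subspaceT/continuous_piX.
by apply: compact_setX; [exact: compact_GLO|exact: compact_Abar].
Qed.

Lemma sim_full (a b : U * Ab) : eqclos (@sim R K v n) a b ->
  (abval a.2).1 = [set: 'I_n.+1]%SET <-> (abval b.2).1 = [set: 'I_n.+1]%SET.
Proof.
move=> h; apply: (h (fun a b => (abval a.2).1 = [set: 'I_n.+1]%SET <->
  (abval b.2).1 = [set: 'I_n.+1]%SET)) => //.
- by move=> ? ? [? ?].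
- by move=> ? ? ? [? ?] [? ?]; split; auto.
move=> {a b h} [g x] [h y] [s [d [_ [/= <- _]]]] /=.
have sT : (s @: [set: 'I_n.+1])%SET = [set: 'I_n.+1]%SET.
  apply/setP => i; rewrite finset.in_setT; apply/imsetP.
  by exists ((s^-1)%g i); rewrite ?permKV.
split=> [->//|e]; apply: (imset_inj (@perm_inj _ s)).
by rewrite e sT.
Qed.

Lemma XsetE (a : U * Ab) :
  Xset (\pi_(Xb) a) <-> (abval a.2).1 = [set: 'I_n.+1]%SET.
Proof.
split=> [[b fb /piP/sim_full [h _]]|fa]; first exact: h.
by exists a.
Qed.

Lemma open_Xset : open (@Xset R K v n).
Proof.
apply: open_piX.
have -> : \pi_(Xb) @^-1` @Xset R K v n = snd @^-1` (A_basic setT : set Ab).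
  rewrite eqEsubset; split=> a /=.
    by move=> /XsetE fa; exists (abval a.2).2 => //; rewrite [LHS]abval_sI fa.
  by move=> [w _ e]; apply/XsetE; rewrite e.
apply: open_comp => [p _|]; first exact: cvg_snd.
rewrite openE => x hx; apply: nbhs_Abar_base => //.
by left; exists setT => //; exact: openT.
Qed.

(** Clamping extends the homotopy to all real times, so continuity can be proved on the whole
    product and then restricted. *)
Definition clamp (s : R) : R := Num.min (Num.max s 0) 1.

Definition contract_rep (a : U * Ab) (s : R) : U * Ab := (a.1, contract_Abar a.2 (clamp s)).

Definition contract_Xbar (p : Xb * R) : Xb := \pi_(Xb) (contract_rep (repr p.1) p.2).

Lemma clamp_ge0 s : 0 <= clamp s.
Proof. by rewrite /clamp le_min ler01 le_max lexx orbT. Qed.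

(** Independence of the representative. Level 0 is separate: the truncated points may lie on the
    boundary, but there truncation is the identity. *)
Lemma contract_XbarE a s : contract_Xbar (\pi_(Xb) a, s) = \pi_(Xb) (contract_rep a s).
Proof.
rewrite /contract_Xbar; set b := repr _.
have hb : eqclos (@sim R K v n) b a by apply/piP; rewrite reprK.
apply/piP; rewrite /contract_rep /=.
have := clamp_ge0 s; rewrite le_eqVlt => /orP[/eqP <-|s0].
  by rewrite !contract_Abar0 -!surjective_pairing.
exact: eqclos_sim (contract_sim hv s0 (eqclos_homothetic hv hb)).
Qed.

Lemma continuous_clamp : continuous clamp.
Proof.
move=> s; have c (F : set_system R) (FF : Filter F) : F --> s -> clamp @ F --> clamp s.
  move=> Fs.
  have h1 : {for (s, 0), continuous (fun p : R * R => Num.max p.1 p.2)}.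
    exact: max_continuous.
  have Fid : (fun t : R => t) @ F --> s by exact: Fs.
  have Fc a : (fun _ : R => a : R) @ F --> (a : R) by exact: cvg_cst.
  have F1 : (fun t => (t, 0 : R)) @ F --> (s, 0 : R) by exact: cvg_pair Fid (Fc 0).
  have h2 : {for (Num.max s 0, 1), continuous (fun p : R * R => Num.min p.1 p.2)}.
    exact: min_continuous.
  have F2 : (fun t => (Num.max t 0, 1 : R)) @ F --> (Num.max s 0, 1 : R).
    exact: cvg_pair (cvg_apply h1 F1) (Fc 1).
  exact: cvg_apply h2 F2.
by have := c (nbhs s) _; apply=> //; exact: cvg_id.
Qed.

Lemma continuous_contract_rep : continuous (fun p : (U * Ab) * R => contract_rep p.1 p.2).
Proof.
move=> p; have c (F : set_system ((U * Ab) * R)) (FF : Filter F) : F --> p ->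
    (fun q => contract_rep q.1 q.2) @ F --> contract_rep p.1 p.2.
  move=> Fp.
  have F1 : (fun q => q.1) @ F --> p.1 by apply: (cvg_apply (h := fst)) Fp; exact: cvg_fst.
  have F2 : (fun q => q.2) @ F --> p.2 by apply: (cvg_apply (h := snd)) Fp; exact: cvg_snd.
  have F11 : (fun q => q.1.1) @ F --> p.1.1 by apply: (cvg_apply (h := fst)) F1; exact: cvg_fst.
  have F12 : (fun q => q.1.2) @ F --> p.1.2 by apply: (cvg_apply (h := snd)) F1; exact: cvg_snd.
  have Fc : (fun q => clamp q.2) @ F --> clamp p.2.
    by apply: (cvg_apply (h := clamp)) F2; exact: continuous_clamp.
  exact: cvg_pair F11 (cvg_contract_Abar F12 Fc).
by have := c (nbhs p) _; apply=> //; exact: cvg_id.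
Qed.

(* The product of a quotient map with the locally compact space [R] is again a
   quotient map; here this is the tube lemma along a closed interval. *)
Lemma continuous_contract_Xbar : continuous contract_Xbar.
Proof.
move=> [z s]; have [a ->] : exists a, z = \pi_(Xb) a by exists (repr z); rewrite reprK.
pose G (p : (U * Ab) * R) := contract_Xbar (\pi_(Xb) p.1, p.2).
have cG : continuous G.
  have -> : G = \pi_(Xb) \o (fun p => contract_rep p.1 p.2).
    by apply/funext => p; exact: contract_XbarE.
  move=> p; apply: continuous_comp; first exact: continuous_contract_rep.
  exact: continuous_piX.
move=> W' nW'; have [W [oW Wz] WW'] : exists2 W, open W /\ W (G (a, s)) & W `<=` W'.
  by move: nW'; rewrite nbhsE => -[W [oW Wz] sW]; exists W.
have nW b t : W (G (b, t)) -> nbhs (b, t) (G @^-1` W).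
  by move=> Wbt; exact: cG (open_nbhs_nbhs (conj oW Wbt)).
have [[A B] /= [nA nB] AB] := nW _ _ Wz.
have /nbhs_ballP [e /= e0 eB] := nB.
pose I := `[s - e / 2, s + e / 2]%classic.
have IB : I `<=` B.
  move=> t; rewrite /I /= in_itv /= => /andP[t1 t2]; apply: eB.
  by rewrite /ball /= ltr_norml; apply/andP; split; lra.
have cI : compact I by exact: segment_compact.
(* Being defined in the quotient, V has a saturated preimage automatically; compactness of I makes
   that preimage open. *)
pose V := [set w : Xb | forall t, I t -> W (contract_Xbar (w, t))].
have oV : open V.
  apply: open_piX; rewrite openE => b Vb.
  have /compact_near_coveringP/(_ _ (nbhs b) (fun b' t => W (G (b', t)))) := cI.
  apply=> t It; have [[A' B'] /= [nA' nB'] AB'] := nW b t (Vb t It).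
  exists (B', A'); first by split.
  move=> [t' b'] [Bt Ab]; exact: (AB' (b', t') (conj Ab Bt)).
have Vz : V (\pi_(Xb) a).
  move=> t It; apply: (AB (a, t)); split=> /=; last exact: IB.
  exact: nbhs_singleton nA.
exists (V, I) => /=; last by move=> [w t] [/= Vw It]; apply: WW'; exact: Vw.
split; first exact: open_nbhs_nbhs.
apply/nbhs_ballP; exists (e / 2); rewrite /= ?divr_gt0// => t.
rewrite /ball /= ltr_norml /I /= in_itv /= => /andP[? ?]; apply/andP; split; lra.
Qed.

Lemma clamp_id (s : R) : 0 <= s <= 1 -> clamp s = s.
Proof. by move=> /andP[s0 s1]; rewrite /clamp max_l// min_l. Qed.

Lemma contract_Xbar0 z : contract_Xbar (z, 0) = z.
Proof.
rewrite -[z]reprK contract_XbarE; case: (repr z) => g x.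
by rewrite /contract_rep clamp_id ?lexx ?ler01//= contract_Abar0.
Qed.

Lemma contractible_Xbar : contractible R Xb.
Proof.
pose z := \pi_(Xb) (mkU (GLO_U0hat hv (GLO1 n hv)), Aorigin R n).
exists contract_Xbar, (contract_Xbar (z, 1)); split.
  exact: continuous_subspaceT continuous_contract_Xbar.
split=> [w|w]; first exact: contract_Xbar0.
rewrite -[w]reprK !contract_XbarE; apply/piP; apply: eqclos_sim.
by rewrite /contract_rep clamp_id ?lexx ?ler01//; exact: contract1_sim.
Qed.

Lemma dense_Xset : dense (@Xset R K v n).
Proof.
move=> W [z Wz] oW.
have : nbhs (z, 0 : R) (contract_Xbar @^-1` W).
  apply: continuous_contract_Xbar; apply: open_nbhs_nbhs; split=> //.
  by rewrite contract_Xbar0.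
move=> [[A B] /= [nA nB] AB]; have /nbhs_ballP [e /= e0 eB] := nB.
pose s := Num.min (e / 2) 1.
have s0 : 0 < s by rewrite /s lt_min divr_gt0//= ltr01.
have s1 : 0 <= s <= 1 by rewrite ltW//= /s ge_min lexx orbT.
have se : s < e by rewrite /s gt_min; apply/orP; left; lra.
exists (contract_Xbar (z, s)); split.
  apply: (AB (z, s)); split => /=; first exact: nbhs_singleton nA.
  by apply: eB; rewrite /ball /= sub0r normrN gtr0_norm.
rewrite -[z]reprK contract_XbarE; apply/XsetE.
rewrite /contract_rep /= clamp_id// abval_of_weight ?truncate_weight_neq0//=.
apply/setP => i; rewrite finset.in_setT inE truncate_weightE.
by rewrite gt_eqF// lt_max s0 orbT.
Qed.

End Compactification.

Theorem theorem4p1 (R : realType) (K : fieldType) (v : K -> \bar R) (n : nat) :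
  nonarch_local_field v ->
  [/\ compact [set: Xbar v n], contractible R (Xbar v n),
      open (@Xset R K v n) & dense (@Xset R K v n)].
Proof.
move=> hv; split.
- exact: compact_Xbar.
- exact: contractible_Xbar.
- exact: open_Xset.
- exact: dense_Xset.
Qed.
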